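(* Let $p\in\mathbb{N}$, $p\ge1$, and let $\phi$ be a strictly positive log-concave probability density on $\mathbb{R}$, with distribution $F$. Let $\mathbf{a},\mathbf{b}\in[0,\infty)^p$ satisfy $\sum_{j=1}^pa_j<1$ and $\sum_{j=1}^pb_j<1$. If $\mathbf{b}\ge\mathbf{a}$ coordinatewise and $\mathbf{b}\ne\mathbf{a}$, then $$\theta_F(\mathbf{b})>\theta_F(\mathbf{a}).$$ Here, for $\mathbf{c}\in[0,\infty)^p$ with $\sum_jc_j<1$, $\theta_F(\mathbf{c})$ is the persistence exponent defined by $$\log\theta_F(\mathbf{c})=\lim_{n\to\infty}\frac1n\log\mathbb{P}_\mu\Big(\min_{0\le i\le n}Z_i\ge0\Big)$$ for the AR($p$) process with coefficient vector $\mathbf{c}$, innovation density $\phi$ and initial distribution $\mu$, where $\mu$ is a probability measure on $\mathbb{R}^p$ such that $\mu(U)>0$ for all non-empty open $U\subseteq[0,\infty)^p$ and, for some $\delta>0$, $$\mathbb{E}_\mu\Big[\exp\Big\{\delta\sum_{j=0}^{p-1}Z_j\Big\}1_{\{\min_{0\le i\le p-1}Z_i\ge0\}}\Big]<\infty.$$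
   Context: AR($p$) process with coefficient vector $\mathbf c=(c_1,\dots,c_p)$: $(Z_0,\dots,Z_{p-1})$ has law $\mu$ and is independent of an i.i.d. sequence $\{\xi_i\}_{i\ge p}$ with density $\phi$; for $i\ge p$, $Z_i:=\sum_{j=1}^pc_jZ_{i-j}+\xi_i$. Under the stated assumptions it is known that the limit defining $\theta_F(\mathbf{c})$ exists and does not depend on the choice of such $\mu$. *)

(* Defs.v *)
From HB Require Import structures.
From mathcomp Require Import all_boot all_order all_algebra.
From mathcomp Require Import all_classical all_reals all_analysis.

Set Implicit Arguments.
Unset Strict Implicit.
Unset Printing Implicit Defensive.

Import Order.TTheory GRing.Theory Num.Theory.
Import numFieldNormedType.Exports.

Local Open Scope classical_set_scope.
Local Open Scope ring_scope.

Definition probability_density (R : realType) (phi : R -> R) : Prop :=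
  [/\ measurable_fun [set: R] phi,
      forall x, 0 <= phi x &
      (\int[lebesgue_measure]_x (phi x)%:E = 1)%E].

Definition log_concave (R : realType) (phi : R -> R) : Prop :=
  forall t x y : R, 0 <= t <= 1 ->
    phi x `^ t * phi y `^ (1 - t) <= phi (t * x + (1 - t) * y).

(** [R^p] is [p.-tuple R], whose measurable structure is the product
    sigma-algebra; the entry [tnth c j] is the coefficient $c_{j+1}$. *)

Definition stable_coefficients (R : realType) (p : nat) (c : p.-tuple R) : Prop :=
  (forall j, 0 <= tnth c j) /\ \sum_(j < p) tnth c j < 1.

(** The topology of [R^p] is only available on row vectors, hence [U]. *)
Definition admissible_initial (R : realType) (p : nat)
    (mu : probability (p.-tuple R) R) : Prop :=
  (forall U : set 'rV[R]_p, open U -> U !=set0 ->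
     (forall x, U x -> forall j, 0 <= x 0 j) ->
     (0 < mu [set z : p.-tuple R | U (\row_j tnth z j)])%E)
  /\
  (exists2 delta : R, 0 < delta &
     (\int[mu]_(z in [set z : p.-tuple R | forall j, (0 <= tnth z j)%R])
        (expR (delta * \sum_(j < p) tnth z j)%R)%:E < +oo)%E).

Section process.
Context (R : realType) (d : measure_display) (T : measurableType d)
  (P : probability T R).
Implicit Types (Z xi : nat -> {RV P >-> R}) (p : nat).

Definition initial_vector p Z (w : T) : p.-tuple R := [tuple Z j w | j < p].

(** Only the variables [xi i] with [p <= i] are constrained or used. *)

Definition iid_with_density (phi : R -> R) p xi : Prop :=
  (forall i (B : set R), (p <= i)%N -> measurable B ->
     P (xi i @^-1` B) = (\int[lebesgue_measure]_(x in B) (phi x)%:E)%E)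
  /\
  (forall (s : seq nat) (B : nat -> set R),
     uniq s -> (forall i, i \in s -> (p <= i)%N) ->
     (forall i, measurable (B i)) ->
     P (\bigcap_(i in [set` s]) (xi i @^-1` B i)) =
       (\prod_(i <- s) P (xi i @^-1` B i))%E).

Definition sigma_noise p xi : set (set T) :=
  <<s [set E | exists i (B : set R),
         [/\ (p <= i)%N, measurable B & E = xi i @^-1` B]] >>.

Definition initial_indep_noise p Z xi : Prop :=
  forall (A : set (p.-tuple R)) (E : set T), measurable A -> sigma_noise p xi E ->
    P ((initial_vector p Z @^-1` A) `&` E) =
      (P (initial_vector p Z @^-1` A) * P E)%E.

Definition ar_process p (mu : probability (p.-tuple R) R) (phi : R -> R)
    (c : p.-tuple R) Z xi : Prop :=
  [/\ forall A : set (p.-tuple R), measurable A ->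
        P (initial_vector p Z @^-1` A) = mu A,
      iid_with_density phi p xi,
      initial_indep_noise p Z xi &
      forall i w, (p <= i)%N ->
        Z i w = \sum_(j < p) tnth c j * Z (i - j.+1)%N w + xi i w].

Definition persistence_probability Z (n : nat) : R :=
  fine (P [set w | forall i, (i <= n)%N -> 0 <= Z i w]).

(** theta_F(c), computed on a realization [Z] of the AR(p) process. [limn] and
    [ln] are total, but for an admissible initial law the probabilities are
    positive and the limit exists, the same for every such law. *)
Definition persistence_exponent Z : R :=
  expR (limn (fun n => n%:R^-1 * ln (persistence_probability Z n))).

End process.

(* Main.v *)
Require Import Defs.
From mathcomp Require Import all_boot all_order all_algebra.
From mathcomp Require Import all_classical all_reals all_analysis.
From mathcomp Require Import measurable_realfun ring lra.
Set Implicit Arguments.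
Unset Strict Implicit.
Unset Printing Implicit Defensive.
Import Order.TTheory GRing.Theory Num.Theory.
Import numFieldNormedType.Exports.
Local Open Scope classical_set_scope.
Local Open Scope ring_scope.

(** Let [u_n(x)] be the probability that the process started from the state
    [x >= 0] stays nonnegative for [n] steps, i.e. [u_n = K^n 1] for the killed
    transition operator [K].  As [K] preserves monotonicity, [u_n(0)] is
    supermultiplicative.  Log-concavity gives exponential moments of the noise,
    hence a potential [V = exp (delta * W)], with [W] linear, such that [K V <= eps V]
    outside a bounded set, for any [eps > 0].  This yields the Harnack inequality
    [u_n(x) <= A V(x) u_n(0)] and [K^n V(0) <= C u_n(0)], so that [u_n(0)] is
    submultiplicative up to a constant: [ln u_n(0) = n L + O(1)].  Integrating the
    Harnack inequality against the initial law identifies the persistence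
    exponent as [exp L].

    For strictness, let [v_n] belong to [b] and [u_n] to [a].  At each step the
    [b]-process gains over the [a]-process a fixed proportion on the box
    [[1, 2]^p], which the surviving [a]-process visits with conditional
    probability bounded below.  Telescoping,
    [v_n(0) >= const * \sum_i u_i(0) v_(n-1-i)(0)]; if the exponents were equal,
    each of the [n] terms would be at least of order [exp (n L)], contradicting
    [v_n(0) <= exp (n L)] for large [n]. *)

Lemma measurable_rectangle (R : realType) p (A : set R) : measurable A ->
  measurable [set x : p.-tuple R | forall j, A (tnth x j)].
Proof.
move=> mA.
have -> : [set x : p.-tuple R | forall j, A (tnth x j)] =
    \bigcap_(j in [set: 'I_p]) ((fun x : p.-tuple R => tnth x j) @^-1` A).
  by apply/seteqP; split => x h j; [move=> _; exact: h | exact: (h j I)].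
apply: fin_bigcap_measurable; first exact: finite_finset.
by move=> j _; rewrite -[X in measurable X]setTI; apply: measurable_tnth.
Qed.

(** * The transition operator killed on leaving the nonnegative half-line *)

Section transition.
Context (R : realType) (p : nat).
Implicit Types (c x y : p.-tuple R) (f g : p.-tuple R -> \bar R).

(** A state lists the last [p] values with the oldest first, whereas [tnth c 0]
    multiplies the most recent one: hence [rev_ord]. *)
Definition lag_sum c x : R := \sum_(j < p) tnth c j * tnth x (rev_ord j).

(** The default value of [nth] appends [t] at the end. *)
Definition shift x (t : R) : p.-tuple R := [tuple nth t x j.+1 | j < p].

Definition nonneg x : Prop := forall j, 0 <= tnth x j.

Definition le_state x y : Prop := forall j, tnth x j <= tnth y j.

(** [z] pairs the current state with the innovation; the value 0 after a negative step is what kills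
    the process. *)
Definition surviving c f (z : p.-tuple R * R) : \bar R :=
  if 0 <= lag_sum c z.1 + z.2 then f (shift z.1 (lag_sum c z.1 + z.2)) else 0%E.

Definition mnonneg f : Prop := measurable_fun setT f /\ forall x, (0 <= f x)%E.

Lemma measurable_lag_sum c : measurable_fun setT (lag_sum c).
Proof.
apply: measurable_sum => j; apply: measurable_funM => //.
exact: measurable_tnth.
Qed.

Lemma tnth_shift x t (j : 'I_p) :
  tnth (shift x t) j = if insub j.+1 is Some k then tnth x k else t.
Proof.
rewrite tnth_mktuple; case: insubP => [k _ kE|].
  by rewrite (tnth_nth t) kE.
by rewrite -leqNgt => pj; rewrite nth_default // size_tuple.
Qed.

Lemma measurable_shift :
  measurable_fun setT (fun z : p.-tuple R * R => shift z.1 z.2).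
Proof.
apply/measurable_fun_tnthP => j.
rewrite (_ : _ \o _ = fun z : p.-tuple R * R =>
   if insub j.+1 is Some k then tnth z.1 k else z.2); last first.
  by apply/funext => z /=; rewrite tnth_shift.
case: insubP => [k _ _|_]; last exact: measurable_snd.
apply: (measurableT_comp (@measurable_tnth _ _ p k)); exact: measurable_fst.
Qed.

Lemma measurable_innovate c : measurable_fun setT
  (fun z : p.-tuple R * R => lag_sum c z.1 + z.2).
Proof.
apply: measurable_funD; last exact: measurable_snd.
exact: (measurableT_comp (measurable_lag_sum c) measurable_fst).
Qed.

Lemma measurable_surviving c f : measurable_fun setT f ->
  measurable_fun setT (surviving c f).
Proof.
move=> mf; apply: measurable_fun_ifT => //.
  apply: measurable_fun_ler => //; exact: measurable_innovate.
apply: (measurableT_comp mf).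
suff h : measurable_fun setT (fun z : p.-tuple R * R => (z.1, lag_sum c z.1 + z.2)).
  exact: (measurableT_comp measurable_shift h).
apply: measurable_fun_pair; first exact: measurable_fst.
exact: measurable_innovate.
Qed.

Lemma surviving_ge0 c f z : (forall x, 0 <= f x)%E -> (0 <= surviving c f z)%E.
Proof. by move=> f0; rewrite /surviving; case: ifP. Qed.

Context (nu : probability R R).

Definition transition c f x : \bar R := (\int[nu]_t surviving c f (x, t))%E.

Lemma measurable_surviving_pair c f x : measurable_fun setT f ->
  measurable_fun setT (fun t => surviving c f (x, t)).
Proof.
move=> mf; exact: (measurableT_comp (measurable_surviving c mf) (pair1_measurable x)).
Qed.

Lemma mnonneg_transition c f : mnonneg f -> mnonneg (transition c f).
Proof.
move=> [mf f0]; split.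
  apply: (@measurable_fun_fubini_tonelli_F _ _ _ _ _ nu (surviving c f)).
    exact: measurable_surviving.
  by move=> z; apply: surviving_ge0.
by move=> x; apply: integral_ge0 => t _; apply: surviving_ge0.
Qed.

Lemma mnonneg_iter c f n : mnonneg f -> mnonneg (iter n (transition c) f).
Proof. by move=> gf; elim: n => // n IH; rewrite iterS; apply: mnonneg_transition. Qed.

Lemma mnonneg_cst (k : R) : 0 <= k -> mnonneg (fun _ => k%:E).
Proof. by move=> k0; split => //= x; rewrite lee_fin. Qed.

Lemma mnonneg_scale (k : R) f : 0 <= k -> mnonneg f -> mnonneg (fun x => k%:E * f x)%E.
Proof.
move=> k0 [mf f0]; split; first exact: measurable_funeM.
by move=> x; rewrite mule_ge0 ?lee_fin.
Qed.

Lemma mnonneg_add f g : mnonneg f -> mnonneg g -> mnonneg (fun x => f x + g x)%E.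
Proof.
move=> [mf f0] [mg g0]; split; first exact: emeasurable_funD.
by move=> x; rewrite adde_ge0.
Qed.

Lemma nonneg_shift x t : nonneg x -> 0 <= t -> nonneg (shift x t).
Proof. by move=> x0 t0 j; rewrite tnth_shift; case: insub. Qed.

Lemma le_transition c f g x : mnonneg f -> mnonneg g -> nonneg x ->
  (forall y, nonneg y -> f y <= g y)%E -> (transition c f x <= transition c g x)%E.
Proof.
move=> [mf f0] [mg g0] x0 fg; apply: ge0_le_integral => //.
- by move=> t _; exact: surviving_ge0.
- exact: measurable_surviving_pair.
- exact: measurable_surviving_pair.
- move=> t _; rewrite /surviving /=; case: ifP => // h.
  by apply: fg; exact: nonneg_shift.
Qed.

Lemma le_iter c f g x n : mnonneg f -> mnonneg g -> nonneg x ->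
  (forall y, nonneg y -> f y <= g y)%E ->
  (iter n (transition c) f x <= iter n (transition c) g x)%E.
Proof.
move=> gf gg x0 fg; elim: n x x0 => [|n IH] x x0 /=; first exact: fg.
by apply: le_transition => //; exact: mnonneg_iter.
Qed.

Lemma eq_transition c f g x : (forall y, f y = g y) ->
  transition c f x = transition c g x.
Proof. by move=> /funext ->. Qed.

Lemma transitionZ c (k : R) f x : 0 <= k -> mnonneg f ->
  transition c (fun y => k%:E * f y)%E x = (k%:E * transition c f x)%E.
Proof.
move=> k0 [mf f0]; rewrite /transition -ge0_integralZl //.
- by apply: eq_integral => t _; rewrite /surviving; case: ifP => //; rewrite mule0.
- exact: measurable_surviving_pair.
- by move=> t _; exact: surviving_ge0.
Qed.

Lemma transitionD c f g x : mnonneg f -> mnonneg g ->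
  transition c (fun y => f y + g y)%E x = (transition c f x + transition c g x)%E.
Proof.
move=> [mf f0] [mg g0]; rewrite /transition -ge0_integralD //.
- by apply: eq_integral => t _; rewrite /surviving; case: ifP => //; rewrite adde0.
- by move=> t _; exact: surviving_ge0.
- exact: measurable_surviving_pair.
- by move=> t _; exact: surviving_ge0.
- exact: measurable_surviving_pair.
Qed.

Lemma iterZ c (k : R) f n x : 0 <= k -> mnonneg f ->
  iter n (transition c) (fun y => k%:E * f y)%E x =
  (k%:E * iter n (transition c) f x)%E.
Proof.
move=> k0 gf; elim: n x => //= n IH x.
by rewrite (eq_transition _ _ IH) transitionZ //; exact: mnonneg_iter.
Qed.

Lemma iterD_fun c f g n x : mnonneg f -> mnonneg g ->
  iter n (transition c) (fun y => f y + g y)%E x =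
  (iter n (transition c) f x + iter n (transition c) g x)%E.
Proof.
move=> gf gg; elim: n x => //= n IH x.
by rewrite (eq_transition _ _ IH) transitionD //; exact: mnonneg_iter.
Qed.

(** Only the smaller state is asked to be nonnegative; the larger one then is as well. *)
Definition increasing f :=
  forall x y, nonneg x -> le_state x y -> (f x <= f y)%E.

Lemma le_shift x y s t : le_state x y -> s <= t -> le_state (shift x s) (shift y t).
Proof. by move=> xy st j; rewrite !tnth_shift; case: insub. Qed.

Lemma le_lag_sum a b x y : nonneg a -> le_state a b -> nonneg x -> le_state x y ->
  lag_sum a x <= lag_sum b y.
Proof. by move=> a0 ab x0 xy; apply: ler_sum => j _; apply: ler_pM. Qed.

Lemma le_state_refl x : le_state x x. Proof. by []. Qed.

(** For one and the same innovation, larger coefficients and a larger state give a larger next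
    value, so the upper process survives whenever the lower one does and stays above it. *)
Lemma le_surviving a b f x y t : (forall x, 0 <= f x)%E -> increasing f ->
  nonneg a -> le_state a b -> nonneg x -> le_state x y ->
  (surviving a f (x, t) <= surviving b f (y, t))%E.
Proof.
move=> f0 fi a0 ab x0 xy; rewrite /surviving /=.
have h := le_lag_sum a0 ab x0 xy.
case: ifPn => h1; last by case: ifP.
rewrite ifT; last by rewrite (le_trans h1) // lerD2r.
by apply: fi; [exact: nonneg_shift | apply: le_shift; rewrite ?lerD2r].
Qed.

Lemma le_transition_state a b f x y : mnonneg f -> increasing f ->
  nonneg a -> le_state a b -> nonneg x -> le_state x y ->
  (transition a f x <= transition b f y)%E.
Proof.
move=> [mf f0] fi a0 ab x0 xy; apply: ge0_le_integral => //.
- by move=> t _; exact: surviving_ge0.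
- exact: measurable_surviving_pair.
- exact: measurable_surviving_pair.
- by move=> t _; exact: le_surviving.
Qed.

Definition survival c n : p.-tuple R -> \bar R := iter n (transition c) (fun _ => 1%E).

Lemma mnonneg_surv c n : mnonneg (survival c n).
Proof. by apply: mnonneg_iter; exact: mnonneg_cst. Qed.

Lemma survival_incr c n : nonneg c -> increasing (survival c n).
Proof.
move=> c0; elim: n => // n IH x y x0 xy.
by apply: le_transition_state => //; exact: mnonneg_surv.
Qed.

Lemma survival_le1 c n x : nonneg x -> (survival c n x <= 1)%E.
Proof.
elim: n x => // n IH x x0.
apply: (@le_trans _ _ (\int[nu]_t (cst 1%E t))%E).
  apply: ge0_le_integral => //.
  - by move=> t _; apply: surviving_ge0; case: (mnonneg_surv c n).
  - by apply: measurable_surviving_pair; case: (mnonneg_surv c n).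
  - move=> t _; rewrite /surviving /=; case: ifP => // h.
    by apply: IH; exact: nonneg_shift.
by rewrite integral_cst // mul1e; exact: probability_le1.
Qed.

Lemma survival_decr c n m x : nonneg x -> (survival c (n + m) x <= survival c n x)%E.
Proof.
move=> x0; rewrite /survival iterD; apply: le_iter => //; first exact: mnonneg_surv.
by move=> y; exact: survival_le1.
Qed.

End transition.

(** * A linear functional contracted by the recursion *)

Section lyapunov.
Context (R : realType) (p : nat).
Implicit Types (c x y : p.-tuple R).

(** The slack in the stability condition, spread evenly over the [p] entries so that the increments
    of [weight] total 1. *)
Definition drift c : R := (1 - \sum_(j < p) tnth c j) / p%:R.

(** With these weights one step of the recursion turns the [j]-th weight [w] into
    [w - drift c <= (1 - drift c) * w]: see [weighted_shift]. *)
Definition weight c (j : 'I_p) : R :=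
  \sum_(i < p | (i <= j)%N) (tnth c (rev_ord i) + drift c).

Definition weighted c x : R := \sum_(j < p) weight c j * tnth x j.

Hypothesis p_gt0 : (0 < p)%N.

Lemma drift_gt0 c : stable_coefficients c -> 0 < drift c.
Proof. by move=> [_ c1]; rewrite divr_gt0 ?subr_gt0 // ltr0n. Qed.

Lemma weight_total c : \sum_(i < p) (tnth c (rev_ord i) + drift c) = 1.
Proof.
rewrite big_split /= (reindex_inj rev_ord_inj) /=.
under eq_bigr do rewrite rev_ordK.
rewrite sumr_const card_ord -(mulr_natr (drift c)) /drift divfK ?pnatr_eq0 -?lt0n //; lra.
Qed.

Lemma weight_le1 c j : stable_coefficients c -> weight c j <= 1.
Proof.
move=> sc; rewrite -(weight_total c) /weight [leRHS](bigID (fun i : 'I_p => (i <= j)%N)) /=.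
rewrite lerDl; apply: sumr_ge0 => i _; rewrite addr_ge0 //; first by case: sc.
exact/ltW/drift_gt0.
Qed.

Lemma weight_ge c j : stable_coefficients c -> drift c <= weight c j.
Proof.
move=> sc; rewrite /weight (bigD1 j) //= -addrA addrCA lerDl.
rewrite addr_ge0 //; first by case: sc.
apply: sumr_ge0 => i _; rewrite addr_ge0 //; first by case: sc.
exact/ltW/drift_gt0.
Qed.

Lemma weighted_ge0 c x : stable_coefficients c -> nonneg x -> 0 <= weighted c x.
Proof.
move=> sc x0; apply: sumr_ge0 => j _; rewrite mulr_ge0 //.
exact/(le_trans _ (weight_ge j sc))/ltW/drift_gt0.
Qed.

Lemma weighted_le c x : stable_coefficients c -> nonneg x ->
  weighted c x <= \sum_(j < p) tnth x j.
Proof.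
by move=> sc x0; apply: ler_sum => j _; rewrite ler_piMl // weight_le1.
Qed.

Lemma le_weighted c x j : stable_coefficients c -> nonneg x ->
  drift c * tnth x j <= weighted c x.
Proof.
move=> sc x0; rewrite /weighted (bigD1 j) //=.
apply: (@le_trans _ _ (weight c j * tnth x j)).
  by rewrite ler_wpM2r // weight_ge.
rewrite lerDl; apply: sumr_ge0 => i _; rewrite mulr_ge0 //.
exact/(le_trans _ (weight_ge i sc))/ltW/drift_gt0.
Qed.

Lemma measurable_weighted c : measurable_fun setT (weighted c).
Proof.
apply: measurable_sum => j; apply: measurable_funM => //.
exact: measurable_tnth.
Qed.
End lyapunov.

(** The newest entry has weight 1 and contributes [lag_sum c x + t]. An old entry moves one place
    down, where its weight is smaller by its coefficient plus [drift c]; [lag_sum] returns the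
    coefficient, which leaves [weight c j - drift c]. The contraction follows from
    [weight c j <= 1]. *)
Lemma weighted_shift (R : realType) p (c x : p.-tuple R) t :
  (0 < p)%N -> stable_coefficients c -> nonneg x ->
  weighted c (shift x (lag_sum c x + t)) <= (1 - drift c) * weighted c x + t.
Proof.
case: p c x => // p c x _ sc x0.
have wmax : weight c ord_max = 1.
  by rewrite -(weight_total _ c) //; apply: eq_bigl => i; rewrite -ltnS ltn_ord.
have wS (i : 'I_p) : weight c (lift ord0 i) =
    weight c (widen_ord (leqnSn p) i) + (tnth c (rev_ord (lift ord0 i)) + drift c).
  rewrite /weight (bigD1 (lift ord0 i)) //= addrC; congr (_ + _).
  apply: eq_bigl => k; rewrite -(inj_eq val_inj) /= /bump add1n.
  by rewrite andbC -ltn_neqAle ltnS.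
have w0 : weight c ord0 = tnth c (rev_ord ord0) + drift c.
  rewrite /weight (bigD1 ord0) //= big1 ?addr0 // => i /andP[].
  by rewrite leqn0 => /eqP h; rewrite -(inj_eq val_inj) /= h.
have -> : weighted c (shift x (lag_sum c x + t)) =
    \sum_(j < p.+1) (weight c j - drift c) * tnth x j + t.
  rewrite /weighted big_ord_recr /= wmax mul1r tnth_shift insubF ?ltnn //.
  rewrite addrA; congr (_ + _).
  have -> : lag_sum c x = \sum_(j < p.+1) tnth c (rev_ord j) * tnth x j.
    rewrite /lag_sum (reindex_inj rev_ord_inj) /=.
    by apply: eq_bigr => j _; rewrite rev_ordK.
  rewrite !big_ord_recl w0 addrK addrCA; congr (_ + _).
  rewrite -big_split /=; apply: eq_bigr => i _.
  rewrite tnth_shift; case: insubP => [k _ kE|]; last by rewrite /= ltnS ltn_ord.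
  have -> : k = lift ord0 i by apply: val_inj; rewrite kE /= /bump.
  rewrite -mulrDl wS; congr (_ * _); ring.
rewrite lerD2r mulrBl mul1r; under eq_bigr do rewrite mulrBl.
rewrite sumrB lerD2l lerN2 mulr_sumr; apply: ler_sum => j _.
rewrite ler_wpM2l //; first exact/ltW/drift_gt0.
by rewrite ler_piMl // weight_le1.
Qed.

(** * The exponential potential and its one-step bound *)

Section harnack.
Context (R : realType) (p : nat) (nu : probability R R) (c : p.-tuple R).
Hypothesis p_gt0 : (0 < p)%N.
Hypothesis sc : stable_coefficients c.

Lemma stable_nonneg : nonneg c. Proof. by case: sc. Qed.

Lemma lag_sum_ge0 x : nonneg x -> 0 <= lag_sum c x.
Proof. by move=> x0; apply: sumr_ge0 => j _; rewrite mulr_ge0 // stable_nonneg. Qed.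

Lemma lag_sum_le x (L : R) : 0 <= L -> (forall j, tnth x j <= L) -> lag_sum c x <= L.
Proof.
move=> L0 xL; apply: (@le_trans _ _ (\sum_(j < p) tnth c j * L)).
  by apply: ler_sum => j _; rewrite ler_wpM2l // stable_nonneg.
by rewrite -mulr_suml ler_piMl // ltW //; case: sc.
Qed.

Definition potential (delta : R) x : \bar R := (expR (delta * weighted c x))%:E.

Lemma mnonneg_potential delta : mnonneg (potential delta).
Proof.
split; last by move=> x; rewrite lee_fin expR_ge0.
apply/measurable_EFinP; apply: measurableT_comp => //.
by apply: measurable_funM => //; exact: measurable_weighted.
Qed.

Lemma potential_ge1 delta x : 0 <= delta -> nonneg x -> (1 <= potential delta x)%E.
Proof.
by move=> d0 x0; rewrite lee_fin -expR0 ler_expR mulr_ge0 // weighted_ge0.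
Qed.

Lemma transition_potential (delta M0 : R) x : 0 <= delta -> nonneg x ->
  (\int[nu]_t (expR (delta * t))%:E <= M0%:E)%E ->
  (transition nu c (potential delta) x <=
    (expR (delta * (1 - drift c) * weighted c x) * M0)%:E)%E.
Proof.
move=> d0 x0 hM; rewrite EFinM.
apply: le_trans; last by apply: (lee_wpmul2l _ hM); rewrite lee_fin expR_ge0.
have mexp : measurable_fun setT (fun t : R => (expR (delta * t))%:E).
  by apply/measurable_EFinP; apply: measurableT_comp => //; exact: measurable_funM.
rewrite -ge0_integralZl //.
apply: ge0_le_integral => //.
- by move=> t _; apply: surviving_ge0; case: (mnonneg_potential delta).
- by apply: measurable_surviving_pair; case: (mnonneg_potential delta).
- exact: measurable_funeM.
- move=> t _; rewrite /surviving /=; case: ifP => h; last first.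
    by rewrite -EFinM lee_fin mulr_ge0 ?expR_ge0.
  rewrite -EFinM lee_fin -expRD ler_expR -mulrA -mulrDr ler_wpM2l //.
  exact: weighted_shift.
Qed.

End harnack.

(** Expresses that [nu] has a density bounded away from 0 on bounded intervals, without naming the
    density. *)
Definition lower_density (R : realType) (nu : probability R R) : Prop :=
  forall L : R, 0 <= L -> exists2 m : R, 0 < m &
    forall s t : R, - L <= s -> s <= t -> t <= L -> ((m * (t - s))%:E <= nu `[s, t[%classic)%E.

Definition origin (R : realType) p : p.-tuple R := [tuple 0 | j < p].

(** A two-sided form of Fekete's lemma, with [L] the supremum of [s m / m]. Superadditivity makes
    [L] finite only together with the second hypothesis: comparing both ratios with [s (m * n)]
    bounds every [s m / m] by [(s n + D) / n]. *)
Lemma quasi_additive_slope (R : realType) (s : nat -> R) (D : R) :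
  (forall n m, s n + s m <= s (n + m)%N) ->
  (forall n m, s (n + m)%N <= s n + s m + D) ->
  exists L, forall n, n%:R * L - D <= s n <= n%:R * L.
Proof.
move=> lo up.
have s0 : s 0%N <= 0 by move: (lo 0 0)%N; rewrite addn0; lra.
have lom n m : m.+1%:R * s n <= s (m.+1 * n)%N.
  elim: m => [|m IH]; first by rewrite mul1r mul1n.
  rewrite mulSn [m.+2%:R]mulrS mulrDl mul1r; apply: le_trans (lo _ _).
  by rewrite lerD2l.
have upm n m : s (m * n)%N <= m%:R * (s n + D).
  elim: m => [|m IH]; first by rewrite mul0n mul0r.
  rewrite mulSn [m.+1%:R]mulrS mulrDl mul1r; apply: le_trans (up _ _) _.
  by rewrite -!addrA lerD2l [leRHS]addrC lerD2r.
pose E := [set s m.+1 / m.+1%:R | m in setT].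
have ubE n : ubound E ((s n.+1 + D) / n.+1%:R).
  move=> _ [m _ <-]; rewrite ler_pdivrMr ?ltr0n // mulrAC ler_pdivlMr ?ltr0n //.
  rewrite mulrC [leRHS]mulrC; apply: le_trans (lom _ _) _.
  by rewrite mulnC; exact: upm.
exists (sup E) => -[|n].
  by rewrite mul0r sub0r s0 andbT; move: (up 0 0)%N; rewrite addn0; lra.
have n0 : 0 < n.+1%:R :> R by rewrite ltr0n.
have E0 : E !=set0 by exists (s 1%N / 1%:R), 0%N.
apply/andP; split.
  rewrite lerBlDr mulrC -ler_pdivlMr //; apply: ge_sup => //; exact: ubE.
rewrite mulrC -ler_pdivrMr //; apply: ub_le_sup; last by exists n.
by exists ((s 1%N + D) / 1%:R); exact: (ubE 0%N).
Qed.

(** * The Harnack inequality and the growth rate of the survival probability from the origin *)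

Section harnack.
Context (R : realType) (p : nat) (nu : probability R R) (c : p.-tuple R).
Implicit Types x y : p.-tuple R.

Lemma transition_ge f x (m l r : R) : mnonneg f -> 0 <= l -> 0 <= m ->
  (forall s, l <= s < r -> (m%:E <= f (shift x s))%E) ->
  (m%:E * nu `[(l - lag_sum c x)%R, (r - lag_sum c x)%R[%classic <= transition nu c f x)%E.
Proof.
move=> [mf f0] l0 m0 hf; rewrite /transition.
set A := [set` _].
have mA : measurable A by exact: measurable_itv.
have mS := measurable_surviving_pair c x mf.
rewrite -(integral_cst nu mA m%:E).
apply: (@le_trans _ _ (\int[nu]_(t in A) surviving c f (x, t))%E).
  apply: ge0_le_integral => //; first exact: measurable_funS mS.
  move=> t; rewrite /A /= in_itv /= => /andP[h1 h2].
  rewrite /surviving /= ifT; last by lra.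
  by apply: hf; lra.
by apply: ge0_subset_integral => // t _; exact: surviving_ge0.
Qed.

Hypothesis p_gt0 : (0 < p)%N.
Hypothesis sc : stable_coefficients c.
Hypothesis dnu : lower_density nu.

(** Each step puts one new value in [[r, r + 1]]; after [p] steps no old entry is left. As [lag_sum]
    stays in [[0, L]], the required innovations lie in [[-L, L]], and each step succeeds with
    probability at least [q]. *)
Lemma reach (r L : R) : 0 <= r -> r + 1 <= L -> exists2 kappa, 0 < kappa &
  forall f (m : R), mnonneg f -> 0 <= m ->
    (forall y, (forall j, r <= tnth y j <= r + 1) -> (m%:E <= f y)%E) ->
  forall x, (forall j, 0 <= tnth x j <= L) ->
    ((kappa * m)%:E <= iter p (transition nu c) f x)%E.
Proof.
move=> r0 rL; have L0 : 0 <= L by lra.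
have [q q0 hq] := dnu L0.
exists (q ^+ p) => [|f m gf m0 hf]; first exact: exprn_gt0.
(* With [i] steps to go, only the [p - i] newest entries must already lie in [[r, r + 1]]. *)
suff H i x : (forall j, 0 <= tnth x j <= L) ->
    (forall j : 'I_p, (i <= j)%N -> r <= tnth x j <= r + 1) ->
    ((q ^+ i * m)%:E <= iter i (transition nu c) f x)%E.
  by move=> x hx; apply: H => // j; rewrite leqNgt ltn_ord.
elim: i x => [|i IH] x xL xr /=.
  by rewrite expr0 mul1r; apply: hf => j; exact: xr.
have qm0 : 0 <= q ^+ i * m by rewrite mulr_ge0 // exprn_ge0 // ltW.
have lag0 : 0 <= lag_sum c x by apply: lag_sum_ge0 => // j; case/andP: (xL j).
have lagL : lag_sum c x <= L by apply: lag_sum_le => // j; case/andP: (xL j).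
apply: le_trans; last first.
  apply: (@transition_ge _ x (q ^+ i * m) r (r + 1)) => //.
    exact: mnonneg_iter.
  move=> s /andP[rs sr]; apply: IH => j.
    by rewrite tnth_shift; case: insub => // ; apply/andP; split; lra.
  move=> ij; rewrite tnth_shift; case: insubP => [k _ kE|_]; last by lra.
  by apply: xr; rewrite kE.
rewrite exprS -mulrA mulrC EFinM lee_wpmul2l ?lee_fin //.
apply: le_trans (hq _ _ _ _ _); rewrite ?lee_fin; last 3 first.
- lra.
- lra.
- lra.
by rewrite (_ : _ - _ - _ = 1) ?mulr1 //; ring.
Qed.

Definition survival0 n : R := fine (survival nu c n (origin R p)).

Lemma origin_nonneg : nonneg (origin R p).
Proof. by move=> j; rewrite tnth_mktuple. Qed.

Lemma survival_fin_num n x : nonneg x -> survival nu c n x \is a fin_num.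
Proof.
move=> x0; rewrite ge0_fin_numE; last by case: (mnonneg_surv nu c n).
by rewrite (le_lt_trans (survival_le1 nu c n x0)) // ltry.
Qed.

Lemma survival0E n : survival nu c n (origin R p) = (survival0 n)%:E.
Proof. by rewrite fineK //; apply: survival_fin_num; exact: origin_nonneg. Qed.

Lemma survival0_ge0 n : 0 <= survival0 n.
Proof. by apply: fine_ge0; case: (mnonneg_surv nu c n). Qed.

Lemma survival0_super n m : survival0 n * survival0 m <= survival0 (n + m).
Proof.
rewrite -lee_fin -survival0E /survival iterD EFinM -[(survival0 n)%:E]survival0E muleC.
rewrite /survival -iterZ ?survival0_ge0 //.
apply: le_iter => //.
- by apply: mnonneg_scale; rewrite ?survival0_ge0 //; exact: mnonneg_cst.
- exact: mnonneg_surv.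
- exact: origin_nonneg.
move=> y y0; rewrite mule1 -survival0E; apply: survival_incr => //.
- exact: stable_nonneg.
- exact: origin_nonneg.
- by move=> j; rewrite tnth_mktuple.
Qed.

Lemma survival0_decr n m : survival0 (n + m) <= survival0 n.
Proof. by rewrite -lee_fin -!survival0E; apply: survival_decr; exact: origin_nonneg. Qed.

Lemma survival0_0 : survival0 0 = 1. Proof. by []. Qed.

Lemma survival0_1_gt0 : 0 < survival0 1.
Proof.
have [q q0 hq] := dnu (@ler01 R).
rewrite -lte_fin -survival0E.
apply: (@lt_le_trans _ _ (1%:E *
    nu `[(0 - lag_sum c (origin R p))%R, (1 - lag_sum c (origin R p))%R[%classic)%E);
  last first.
  by apply: transition_ge => //; exact: mnonneg_cst.
have l0 : lag_sum c (origin R p) = 0.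
  by apply: big1 => j _; rewrite tnth_mktuple mulr0.
have -> : 0 - lag_sum c (origin R p) = 0 by rewrite l0 subrr.
have -> : 1 - lag_sum c (origin R p) = 1 by rewrite l0 subr0.
rewrite mul1e; apply: (lt_le_trans _ (hq 0 1 _ _ _)) => //; rewrite ?lerN10 //.
by rewrite lte_fin subr0 mulr1.
Qed.

Lemma survival0_gt0 n : 0 < survival0 n.
Proof.
elim: n => [|n IH]; first by rewrite survival0_0.
by rewrite -addn1; apply: lt_le_trans (survival0_super _ _); rewrite mulr_gt0 // survival0_1_gt0.
Qed.

Context (delta M0 : R).
Hypothesis delta_gt0 : 0 < delta.
Hypothesis hM0 : (\int[nu]_t (expR (delta * t))%:E <= M0%:E)%E.
Let V := potential c delta.
Let K := transition nu c.

(** By [transition_potential], the ratio of [K V] to [V] is at most [M * expR (- delta * drift c *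
    weighted c x)], which drops below [eps] once [weighted c x] reaches [r]. Below that level [K V]
    is bounded by a constant. *)
Lemma lyapunov (eps : R) : 0 < eps -> exists r C : R, [/\ 0 <= r, 0 <= C,
  (forall x, nonneg x -> r <= weighted c x -> (K V x <= eps%:E * V x)%E) &
  (forall x, nonneg x -> (K V x <= eps%:E * V x + C%:E)%E)].
Proof.
(* The maximum with 1 makes the moment bound positive, so that [ln (M / eps)] is meaningful. *)
move=> eps0; pose M := Num.max M0 1.
have M_gt0 : 0 < M by rewrite lt_max ltr01 orbT.
have hM : (\int[nu]_t (expR (delta * t))%:E <= M%:E)%E.
  by apply: le_trans hM0 _; rewrite lee_fin le_max lexx.
have e0 := drift_gt0 p_gt0 sc.
have de0 : 0 < delta * drift c by rewrite mulr_gt0.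
pose r := Num.max 0 (ln (M / eps) / (delta * drift c)).
have r0 : 0 <= r by rewrite le_max lexx.
have hr x : nonneg x -> r <= weighted c x -> (K V x <= eps%:E * V x)%E.
  move=> x0 rx.
  apply: le_trans (transition_potential p_gt0 sc (ltW delta_gt0) x0 hM) _.
  rewrite -EFinM lee_fin mulrBr mulr1 mulrBl expRD expRN -mulrA mulrC.
  rewrite ler_wpM2r ?expR_ge0 // ler_pdivrMl ?expR_gt0 // -ler_pdivrMr //.
  have Me0 : 0 < M / eps by rewrite divr_gt0.
  rewrite -[leLHS]lnK ?posrE // ler_expR [leRHS]mulrC -ler_pdivrMr //.
  by apply: le_trans rx; rewrite le_max lexx orbT.
exists r, (expR (delta * r) * M); split => //.
  by rewrite mulr_ge0 ?expR_ge0 // ltW.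
move=> x x0; have [rx|xr] := leP r (weighted c x).
  apply: le_trans (hr x x0 rx) _; rewrite leeDl // lee_fin.
  by rewrite mulr_ge0 ?expR_ge0 // ltW.
apply: le_trans (transition_potential p_gt0 sc (ltW delta_gt0) x0 hM) _.
apply: (@le_trans _ _ (expR (delta * r) * M)%:E); last first.
  by rewrite leeDr // -EFinM lee_fin mulr_ge0 ?expR_ge0 // ltW.
rewrite lee_fin ler_wpM2r ?(ltW M_gt0) // ler_expR.
rewrite -mulrA ler_wpM2l //; first exact: ltW.
apply: le_trans (ltW xr).
rewrite ler_piMl ?weighted_ge0 //; lra.
Qed.

(** Outside a sublevel set of [weighted c] the potential decreases by a factor
    [survival0 1] at each step, which pays for [survival0 n.+1 >= survival0 1 *
    survival0 n]; inside it, [reach] compares [x] with the origin. *)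
Lemma harnack : exists2 A, 0 < A & forall n x, nonneg x ->
  (survival nu c n x <= (A * survival0 n)%:E * V x)%E.
Proof.
have [r [_ [r0 _ hr _]]] := lyapunov survival0_1_gt0.
have e0 := drift_gt0 p_gt0 sc.
pose h := r / drift c.
have h0 : 0 <= h by rewrite divr_ge0 // ltW.
have [kappa k0 hk] := reach h0 (lexx _).
(* By [le_weighted] all entries of [x] are at most [h], so a state with entries in [[h, h + 1]]
   dominates [x]; the origin reaches such states in [p] steps with probability at least [kappa]. *)
have hsmall n x : nonneg x -> weighted c x <= r ->
    (survival nu c n x <= (kappa^-1 * survival0 n)%:E)%E.
  move=> x0 xr; rewrite -(fineK (survival_fin_num n x0)) lee_fin ler_pdivlMl //.
  apply: le_trans (survival0_decr n p); rewrite addnC -lee_fin -survival0E /survival iterD.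
  apply: hk; first exact: mnonneg_surv.
  - by apply: fine_ge0; have [_] := mnonneg_surv nu c n; exact.
  - move=> y hy; rewrite fineK; last exact: survival_fin_num.
    apply: (survival_incr nu n (stable_nonneg sc)) => //.
    move=> j; have /andP[hj _] := hy j; apply: le_trans hj.
    rewrite /h ler_pdivlMr // mulrC; apply: le_trans xr; exact: le_weighted.
  - move=> j; rewrite tnth_mktuple lexx /=; lra.
(* The 1 serves for [n = 0], the [kappa^-1] for the sublevel set. *)
exists (1 + kappa^-1) => [|n]; first by rewrite addr_gt0 // invr_gt0.
have ki0 : 0 < kappa^-1 by rewrite invr_gt0.
have A0 : 0 <= 1 + kappa^-1 by lra.
have AU m : 0 <= (1 + kappa^-1) * survival0 m by rewrite mulr_ge0 // survival0_ge0.
elim: n => [|n IH] x x0.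
  rewrite survival0_0 mulr1; apply: (@le_trans _ _ (V x)).
    exact: potential_ge1 (ltW delta_gt0) x0.
  rewrite -EFinM lee_fin ler_peMl ?expR_ge0 //; lra.
have [xr|rx] := leP (weighted c x) r.
  apply: le_trans (hsmall _ _ x0 xr) _.
  apply: (@le_trans _ _ ((1 + kappa^-1) * survival0 n.+1)%:E).
    rewrite lee_fin ler_wpM2r ?survival0_ge0 //; lra.
  rewrite -EFinM lee_fin ler_peMr //.
  by rewrite -lee_fin; exact: potential_ge1 (ltW delta_gt0) x0.
apply: (@le_trans _ _ (K (fun y => ((1 + kappa^-1) * survival0 n)%:E * V y)%E x)).
  apply: le_transition => //; first exact: mnonneg_surv.
  by apply: mnonneg_scale => //; exact: mnonneg_potential.
rewrite /K transitionZ //; last exact: mnonneg_potential.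
apply: le_trans (lee_wpmul2l _ (hr x x0 (ltW rx))) _; first by rewrite lee_fin.
rewrite muleA -(EFinM _ (survival0 1)); apply: lee_wpmul2r; rewrite lee_fin ?expR_ge0 //.
rewrite -mulrA ler_wpM2l //.
by apply: le_trans (survival0_super _ _) _; rewrite addn1.
Qed.

(** With [eps = survival0 1 / 2], a bound [B * survival0 n] on the iterate uses up only half of
    [B * survival0 n.+1] at the next step, by supermultiplicativity. The other half absorbs the
    additive term [C * survival0 n]. *)
Lemma iter_potential : exists2 C, 0 < C & forall n,
  (iter n K V (origin R p) <= (C * survival0 n)%:E)%E.
Proof.
have eta0 := survival0_1_gt0.
have eps0 : 0 < survival0 1 / 2 by rewrite divr_gt0.
have [r [C [r0 C0 _ hC]]] := lyapunov eps0.
have sup1 n : survival0 1 * survival0 n <= survival0 n.+1.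
  by rewrite -[n.+1]add1n; exact: survival0_super.
have [v hv] : exists v, V (origin R p) = v%:E by eexists; reflexivity.
(* [|v|] covers [n = 0], and the last term makes half of [B * survival0 1] at least [C]. *)
exists (1 + `|v| + C * 2 / survival0 1).
  by rewrite ltr_wpDr ?ltr_wpDr // divr_ge0 // ?mulr_ge0 // ltW.
elim=> [|n IH].
  rewrite survival0_0 mulr1 /= hv lee_fin.
  have := ler_norm v; have : 0 <= C * 2 / survival0 1.
    by rewrite divr_ge0 // ?mulr_ge0 // ltW.
  lra.
set B := _ + _ in IH *.
rewrite iterSr.
apply: (@le_trans _ _ 
  (iter n K (fun y => (survival0 1 / 2)%:E * V y + C%:E * 1)%E (origin R p))).
  apply: le_iter.
  - by apply: mnonneg_transition; exact: mnonneg_potential.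
  - apply: mnonneg_add; first by apply: mnonneg_scale; [exact: ltW|exact: mnonneg_potential].
    by apply: mnonneg_scale => //; exact: mnonneg_cst.
  - exact: origin_nonneg.
  - by move=> y y0; rewrite mule1; exact: hC.
rewrite iterD_fun; [|by apply: mnonneg_scale; [exact: ltW|exact: mnonneg_potential]|
  by apply: mnonneg_scale => //; exact: mnonneg_cst].
rewrite (@iterZ _ _ nu c _ V); [|exact: ltW|exact: mnonneg_potential].
rewrite (@iterZ _ _ nu c _ (fun _ => 1%E)); [|by []|exact: mnonneg_cst].
rewrite -/(survival nu c n) survival0E -EFinM.
apply: le_trans (leeD2r _ (lee_wpmul2l _ IH)) _; first by rewrite lee_fin ltW.
rewrite -EFinM -EFinD lee_fin.
have : B * (survival0 1 * survival0 n) <= B * survival0 n.+1.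
  apply: ler_wpM2l (sup1 n); rewrite /B addr_ge0 ?addr_ge0 //.
  by rewrite divr_ge0 // ?mulr_ge0 // ltW.
apply: le_trans.
rewrite [leRHS](_ : _ =
  survival0 1 / 2 * (B * survival0 n) + (B * survival0 1 / 2) * survival0 n); last by field.
rewrite lerD2l ler_wpM2r ?survival0_ge0 // ler_pdivlMr // -ler_pdivrMr // /B.
by rewrite lerDr addr_ge0.
Qed.

Lemma survival0_slope : exists L D, forall n, n%:R * L - D <= ln (survival0 n) <= n%:R * L.
Proof.
have [A A0 hA] := harnack; have [C C0 hC] := iter_potential.
suff [L hL] : exists L, forall n, n%:R * L - ln (A * C) <= ln (survival0 n) <= n%:R * L.
  by exists L, (ln (A * C)).
have AC : 0 < A * C by rewrite mulr_gt0.
apply: quasi_additive_slope => n m.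
  rewrite -lnM ?posrE ?survival0_gt0 // ler_ln ?posrE ?survival0_gt0 ?mulr_gt0 ?survival0_gt0 //.
  exact: survival0_super.
(* Submultiplicativity up to the factor [A * C]: Harnack for the last [m] steps, [iter_potential]
   for the first [n]. *)
rewrite -!lnM ?posrE ?mulr_gt0 ?survival0_gt0 // ler_ln ?posrE ?mulr_gt0 ?survival0_gt0 //.
rewrite -lee_fin -survival0E /survival iterD.
have AU : 0 <= A * survival0 m by rewrite mulr_ge0 ?survival0_ge0 // ltW.
apply: (@le_trans _ _ (iter n K (fun y => (A * survival0 m)%:E * V y)%E (origin R p))).
  apply: le_iter; first exact: mnonneg_surv.
  - by apply: mnonneg_scale => //; exact: mnonneg_potential.
  - exact: origin_nonneg.
  - exact: hA.
rewrite iterZ //; last exact: mnonneg_potential.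
apply: le_trans (lee_wpmul2l _ (hC n)) _; first by rewrite lee_fin.
rewrite -EFinM lee_fin le_eqVlt; apply/orP; left; apply/eqP; ring.
Qed.

End harnack.

(** * Comparison of two coefficient vectors and the strict inequality of slopes *)

Section comparison.
Context (R : realType) (p : nat) (nu : probability R R) (a b : p.-tuple R).
Implicit Types x y : p.-tuple R.
Hypothesis p_gt0 : (0 < p)%N.
Hypotheses (sa : stable_coefficients a) (sb : stable_coefficients b).
Hypothesis ab : le_state a b.
Hypothesis dnu : lower_density nu.

(** The left side runs [n] steps with [a], then [m] with [b]. Induction turns the [a]-steps into
    [b]-steps one at a time, by monotonicity of [survival nu b]. *)
Lemma le_iter_surv n m x : nonneg x ->
  (iter n (transition nu a) (survival nu b m) x <= survival nu b (n + m) x)%E.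
Proof.
elim: n x => // n IH x x0; rewrite iterS.
apply: (@le_trans _ _ (transition nu a (survival nu b (n + m)) x)).
  by apply: le_transition => //; [apply: mnonneg_iter|]; exact: mnonneg_surv.
apply: le_transition_state => //; first exact: mnonneg_surv.
- exact: (survival_incr nu _ (stable_nonneg sb)).
- exact: stable_nonneg.
Qed.

Lemma le_survival0 n : survival0 nu a n <= survival0 nu b n.
Proof.
by rewrite -lee_fin -!survival0E -{2}[n]addn0; apply: le_iter_surv; exact: origin_nonneg.
Qed.

(** Entries at least 1 separate the two lag sums by at least the sum of [b - a]; entries at most 2
    keep the lag sums in a range where [lower_density] applies. *)
Definition box : set (p.-tuple R) := [set x | forall j, 1 <= tnth x j <= 2].

Lemma measurable_box : measurable box.
Proof.
have -> : box = [set x | forall j, `[1, 2]%classic (tnth x j)].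
  by apply/seteqP; split => x /= h j; have := h j; rewrite /= in_itv.
by apply: measurable_rectangle; exact: measurable_itv.
Qed.

Definition in_box x : \bar R := (\1_box x)%:E.

Lemma mnonneg_in_box : mnonneg in_box.
Proof.
split; last by move=> x; rewrite lee_fin.
by apply/measurable_EFinP; apply: measurable_indic; exact: measurable_box.
Qed.

(** An innovation between [- lag_sum b x] and [- lag_sum a x] kills the
    [a]-process but not the [b]-process. *)
Lemma transition_gain : a <> b -> exists2 g, 0 < g & forall f x, mnonneg f -> increasing f ->
  nonneg x ->
  (transition nu a f x + (g%:E * f (origin R p)) * in_box x <= transition nu b f x)%E.
Proof.
move=> neq_ab.
have [m m0 hm] := dnu (ler0n R 2).
pose gap : R := \sum_(j < p) (tnth b j - tnth a j).
have gap_term j : 0 <= tnth b j - tnth a j by rewrite subr_ge0.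
have gap0 : 0 < gap.
  rewrite lt_def sumr_ge0 // andbT; apply/eqP => /eqP.
  rewrite psumr_eq0 // => /allP h; apply: neq_ab; apply: eq_from_tnth => j.
  by have := h j; rewrite mem_index_enum subr_eq0 => /(_ isT) /eqP.
exists (m * gap) => [|f x gf fi x0]; first by rewrite mulr_gt0.
rewrite /in_box indicE; have [xB|_] := boolP (x \in box); last first.
  rewrite mule0 adde0; apply: le_transition_state => //; exact: stable_nonneg.
rewrite mule1; rewrite inE in xB.
have lab := le_lag_sum (stable_nonneg sa) ab x0 (@le_state_refl _ _ x).
have lagb0 := lag_sum_ge0 sb x0; have laga0 := lag_sum_ge0 sa x0.
have lagb2 : lag_sum b x <= 2 by apply: lag_sum_le => // j; case/andP: (xB j).
have gap_lag : gap <= lag_sum b x - lag_sum a x.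
  rewrite /lag_sum -sumrB; apply: ler_sum => j _; rewrite -mulrBl ler_peMr //.
  by case/andP: (xB (rev_ord j)).
(* The mass of [A] is at least [m * gap]. On [A] the next state of the [b]-process dominates the
   origin, hence the factor [f (origin R p)]. *)
pose A := `[- lag_sum b x, - lag_sum a x[%classic : set R.
have mA : measurable A by exact: measurable_itv.
have [mf f0] := gf.
have hA : ((m * gap)%:E * f (origin R p) <= \int[nu]_t (f (origin R p) * (\1_A t)%:E))%E.
  rewrite ge0_integralZl //; last by apply/measurable_EFinP; exact: measurable_indic.
  rewrite integral_indic // setIT muleC; apply: lee_wpmul2l => //.
  apply: le_trans (hm _ _ _ _ _); rewrite ?lerN2 ?lee_fin //; last lra.
  by rewrite opprK addrC ler_pM2l.
apply: le_trans (leeD2l _ hA) _.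
rewrite /transition -ge0_integralD //.
- apply: ge0_le_integral => //.
  + by move=> t _; rewrite adde_ge0 ?mule_ge0 ?surviving_ge0 // lee_fin.
  + apply: emeasurable_funD; first exact: measurable_surviving_pair.
    by apply: measurable_funeM; exact/measurable_EFinP/measurable_indic.
  + exact: measurable_surviving_pair.
  move=> t _; rewrite indicE; have [tA|tA] := boolP (t \in A).
    move: tA; rewrite inE /A /= in_itv /= => /andP[h1 h2].
    rewrite mule1 /surviving /= ifF ?add0e; last by apply/negbTE; rewrite -ltNge; lra.
    rewrite ifT; last by lra.
    apply: fi; first exact: origin_nonneg.
    move=> j; rewrite tnth_mktuple; apply: nonneg_shift => //; lra.
  rewrite mule0 adde0; apply: le_surviving => //; exact: stable_nonneg.
- by move=> t _; exact: surviving_ge0.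
- exact: measurable_surviving_pair.
- by move=> t _; rewrite mule_ge0 // lee_fin.
- by apply: measurable_funeM; exact/measurable_EFinP/measurable_indic.
Qed.

Context (delta M0 : R).
Hypothesis delta_gt0 : 0 < delta.
Hypothesis hM0 : (\int[nu]_t (expR (delta * t))%:E <= M0%:E)%E.

(** Markov's inequality for the killed process: by [iter_potential], at time [n] the potential is at
    most [C] on average given survival, so large values of [weighted a] are unlikely. From the other
    states, [reach] leads to the box in [p] steps. *)
Lemma box_visits : exists2 k, 0 < k & forall n,
  ((k * survival0 nu a (p + n))%:E <=
    iter (p + n) (transition nu a) in_box (origin R p))%E.
Proof.
have [C C0 hC] := iter_potential p_gt0 sa dnu delta_gt0 hM0.
have e0 := drift_gt0 p_gt0 sa.
pose r := Num.max 0 (ln (2 * C) / delta).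
have r0 : 0 <= r by rewrite le_max lexx.
pose L := r / drift a + 2.
have rd0 : 0 <= r / drift a by rewrite divr_ge0 // ltW.
have [kappa k0 hk] := @reach R p nu a sa dnu 1 L ler01 ltac:(rewrite /L; lra).
exists (kappa / 2) => [|n]; first by rewrite divr_gt0.
have box1 y : (forall j, 1 <= tnth y j <= 1 + 1) -> (1%:E <= in_box y)%E.
  by move=> hy; rewrite /in_box indicE mem_set.
(* Beyond level [r] the potential is at least [2 * C], so [theta] times it exceeds [kappa]; on
   average this correction costs only [theta * C = kappa / 2]. *)
pose theta := kappa / (2 * C).
have t0 : 0 <= theta by rewrite divr_ge0 ?mulr_ge0 // ltW.
have cover x : nonneg x -> (kappa%:E * 1 <=
    iter p (transition nu a) in_box x + theta%:E * potential a delta x)%E.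
  move=> x0; rewrite mule1; have [xr|rx] := leP (weighted a x) r.
    apply: (@le_trans _ _ (iter p (transition nu a) in_box x)).
      rewrite -[kappa]mulr1; apply: hk => //; first exact: mnonneg_in_box.
      move=> j; rewrite x0 /= /L ler_wpDr // ler_pdivlMr // mulrC.
      exact: (le_trans (le_weighted p_gt0 j sa x0) xr).
    by rewrite leeDl // -EFinM lee_fin mulr_ge0 // expR_ge0.
  apply: (@le_trans _ _ (theta%:E * potential a delta x)%E); last first.
    by rewrite leeDr //; have [_] := mnonneg_iter nu a p mnonneg_in_box; exact.
  rewrite -EFinM lee_fin /theta -mulrA ler_peMr ?(ltW k0) //.
  have C20 : 0 < 2 * C by rewrite mulr_gt0.
  rewrite ler_pdivlMl // mulr1 -[leLHS]lnK ?posrE // ler_expR [leRHS]mulrC -ler_pdivrMr //.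
  by apply: le_trans (ltW rx); rewrite le_max lexx orbT.
have o0 : nonneg (origin R p) := @origin_nonneg R p.
have gp : mnonneg (iter p (transition nu a) in_box).
  by apply: mnonneg_iter; exact: mnonneg_in_box.
have gV : mnonneg (fun x => theta%:E * potential a delta x)%E.
  by apply: mnonneg_scale => //; exact: mnonneg_potential.
have gk : mnonneg (fun _ : p.-tuple R => kappa%:E * 1)%E.
  by apply: mnonneg_scale; [exact: ltW|exact: mnonneg_cst].
have := @le_iter R p nu a _ _ (origin R p) n gk (mnonneg_add gp gV) o0 cover.
rewrite iterD_fun // (@iterZ _ _ nu a _ (fun _ => 1%E)) ?(ltW k0) //.
rewrite (@iterZ _ _ nu a _ (potential a delta)) //; last exact: mnonneg_potential.
rewrite -iterD addnC -/(survival nu a n) survival0E.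
have gb : mnonneg (iter (p + n) (transition nu a) in_box).
  by apply: mnonneg_iter; exact: mnonneg_in_box.
move=> h; apply: (@le_trans _ _ (kappa / 2 * survival0 nu a n)%:E).
  rewrite lee_fin ler_wpM2l ?divr_ge0 ?(ltW k0) // addnC; exact: survival0_decr.
have h2 : (kappa%:E * (survival0 nu a n)%:E <=
    iter (p + n) (transition nu a) in_box (origin R p) + (theta * (C * survival0 nu a n))%:E)%E.
  apply: le_trans h _; rewrite leeD2l // (EFinM theta).
  by apply: lee_wpmul2l; rewrite ?lee_fin.
rewrite -leeBlDr // -EFinM -EFinB in h2; apply: le_trans h2.
rewrite lee_fin le_eqVlt; apply/orP; left; apply/eqP; rewrite /theta; field.
by rewrite gt_eqF.
Qed.

(** If [Lb <= La], the telescoped gains force [survival0 nu b (p + m)] to be at least [m * c] times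
    [expR ((p + m)%:R * La)], whereas the upper bound allows at most a factor 1. *)
Lemma slope_lt (La D Lb : R) : a <> b ->
  (forall n, n%:R * La - D <= ln (survival0 nu a n)) ->
  (forall n, ln (survival0 nu b n) <= n%:R * Lb) -> La < Lb.
Proof.
move=> neq_ab lo up; rewrite ltNge; apply/negP => Lba.
have [g g0 hg] := transition_gain neq_ab; have [k k0 hk] := box_visits.
have u_lo n : expR (n%:R * La - D) <= survival0 nu a n.
  by rewrite -[leRHS]lnK ?posrE ?survival0_gt0 // ler_expR.
have v_lo n : expR (n%:R * La - D) <= survival0 nu b n.
  exact: le_trans (u_lo n) (le_survival0 n).
(* The product of the gain [g], the box frequency [k] and the lower bounds for the survival factors
   before and after the gaining step; each factor costs one [D]. *)
pose G (N : nat) := g * k * expR (N%:R * La - 2 * D).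
have G0 N : 0 <= G N by rewrite /G !mulr_ge0 ?expR_ge0 // ltW.
have o0 : nonneg (origin R p) := @origin_nonneg R p.
(* Replacing [a] by [b] in one more of the first [m] remaining steps gains at least
   [G N], where [N.+1] is the total number of steps, whichever step it is. *)
have step i m : ((m%:R * G (p + i + m).-1)%:E <=
    iter (p + i) (transition nu a) (survival nu b m) (origin R p))%E.
  elim: m i => [|m IH] i.
    by rewrite mul0r; have [_] := mnonneg_iter nu a (p + i) (mnonneg_surv nu b 0); exact.
  have c0 : 0 <= g * survival0 nu b m by rewrite mulr_ge0 ?survival0_ge0 // ltW.
  apply: (@le_trans _ _ (iter (p + i) (transition nu a) (fun x =>
      transition nu a (survival nu b m) x +
      (g * survival0 nu b m)%:E * in_box x)%E (origin R p))); last first.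
    apply: le_iter => //.
    - apply: mnonneg_add; first by apply: mnonneg_transition; exact: mnonneg_surv.
      by apply: mnonneg_scale => //; exact: mnonneg_in_box.
    - exact: mnonneg_surv.
    move=> y y0; rewrite EFinM -survival0E; apply: hg => //; first exact: mnonneg_surv.
    exact: (survival_incr nu m (stable_nonneg sb)).
  rewrite iterD_fun; [|by apply: mnonneg_transition; exact: mnonneg_surv|
    by apply: mnonneg_scale => //; exact: mnonneg_in_box].
  rewrite iterZ //; last exact: mnonneg_in_box.
  rewrite -iterSr -addnS.
  apply: le_trans (leeD (IH i.+1) (lee_wpmul2l _ (hk i))); last by rewrite lee_fin.
  rewrite -EFinM -EFinD lee_fin -natr1 mulrDl mul1r.
  have -> : (p + i.+1 + m = p + i + m.+1)%N by rewrite !addnS addSn.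
  rewrite lerD2l addnS /= /G.
  have -> : expR ((p + i + m)%:R * La - 2 * D) =
      expR (m%:R * La - D) * expR ((p + i)%:R * La - D).
    by rewrite -expRD natrD; congr expR; ring.
  rewrite [leLHS](_ : _ =
    (g * expR (m%:R * La - D)) * (k * expR ((p + i)%:R * La - D))); last by ring.
  apply: ler_pM; rewrite ?mulr_ge0 ?expR_ge0 ?(ltW g0) ?(ltW k0) //.
    by rewrite ler_pM2l.
  by rewrite ler_pM2l.
have main m : m%:R * G (p + m).-1 <= expR ((p + m)%:R * La).
  apply: (@le_trans _ _ (survival0 nu b (p + m))).
    rewrite -lee_fin -survival0E; have := step 0%N m; rewrite addn0 => /le_trans; apply.
    exact: le_iter_surv.
  rewrite -[leLHS]lnK ?posrE ?survival0_gt0 // ler_expR; apply: le_trans (up _) _.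
  by rewrite ler_wpM2l.
(* [expR (- La)] accounts for the gaining step, which [G] leaves out. *)
pose c := g * k * expR (- La - 2 * D).
have c0 : 0 < c by rewrite /c !mulr_gt0 // expR_gt0.
have bounded m : m%:R * c <= 1.
  have := main m; rewrite /G.
  have -> : ((p + m).-1%:R : R) = (p + m)%:R - 1.
    by rewrite -subn1 natrB // addn_gt0 p_gt0.
  rewrite (_ : _ * La - 2 * D = (p + m)%:R * La + (- La - 2 * D)); last by ring.
  rewrite expRD [leLHS](_ : _ = m%:R * c * expR ((p + m)%:R * La)); last by rewrite /c; ring.
  by rewrite ger_pMl // expR_gt0.
have := bounded (Num.truncn c^-1).+1; rewrite -ler_pdivlMr // mul1r.
by rewrite leNgt truncnS_gt.
Qed.

End comparison.

(** * Log-concave noise: local lower bound, right tail and exponential moments *)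

Section noise.
Context (R : realType) (phi : R -> R) (nu : probability R R).
Hypothesis hphi : probability_density phi.
Hypothesis phi_gt0 : forall x, 0 < phi x.
Hypothesis phi_lc : log_concave phi.
Hypothesis nuE : forall B : set R, measurable B ->
  nu B = (\int[lebesgue_measure]_(x in B) (phi x)%:E)%E.

Let mphi : measurable_fun setT (fun x => (phi x)%:E).
Proof. by apply/measurable_EFinP; case: hphi. Qed.

(** A weighted geometric mean is at least the minimum of its two terms. *)
Lemma log_concave_min x y t : 0 <= t <= 1 ->
  Num.min (phi x) (phi y) <= phi (t * x + (1 - t) * y).
Proof.
move=> t01; apply: le_trans (phi_lc _ _ t01); set m := Num.min _ _.
have m0 : 0 < m by rewrite lt_min !phi_gt0.
case/andP: t01 => t0 t1.
have t_total : t + (1 - t) = 1 by ring.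
have -> : m = m `^ t * m `^ (1 - t).
  by rewrite -powRD t_total ?oner_eq0 // powRr1 // ltW.
apply: ler_pM; rewrite ?powR_ge0 //; apply: ge0_ler_powR => //;
  rewrite ?nnegrE ?(ltW m0) ?(ltW (phi_gt0 _)) ?subr_ge0 //.
- by rewrite ge_min lexx.
- by rewrite ge_min lexx orbT.
Qed.

Lemma lebesgue_itv (s t : R) : s <= t ->
  lebesgue_measure (`[s, t[%classic : set R) = (t - s)%:E.
Proof.
move=> st; rewrite lebesgue_measure_itv /= lte_fin; case: ltP => [_|ts] //.
by rewrite (_ : t - s = 0) //; lra.
Qed.

Lemma itv_integral_lower (m s t : R) : s <= t -> 0 <= m ->
  (forall u, s <= u <= t -> m <= phi u) -> ((m * (t - s))%:E <= nu `[s, t[%classic)%E.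
Proof.
move=> st m0 hm; have mI : measurable (`[s, t[%classic : set R) by exact: measurable_itv.
rewrite nuE //; apply: (@le_trans _ _ (\int[lebesgue_measure]_(x in `[s, t[%classic) m%:E)%E).
  by rewrite integral_cst // EFinM -(lebesgue_itv st).
apply: ge0_le_integral => //; first exact: measurable_funS mphi.
by move=> u; rewrite /= in_itv /= => /andP[su ut]; rewrite lee_fin hm // su ltW.
Qed.

Lemma itv_integral_upper (m s t : R) : s <= t -> 0 <= m ->
  (forall u, s <= u <= t -> phi u <= m) -> (nu `[s, t[%classic <= (m * (t - s))%:E)%E.
Proof.
move=> st m0 hm; have mI : measurable (`[s, t[%classic : set R) by exact: measurable_itv.
rewrite nuE //; apply: (@le_trans _ _ (\int[lebesgue_measure]_(x in `[s, t[%classic) m%:E)%E).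
  apply: ge0_le_integral => //; first by move=> u _; rewrite lee_fin ltW.
    exact: measurable_funS mphi.
  by move=> u; rewrite /= in_itv /= => /andP[su ut]; rewrite lee_fin hm // su ltW.
by rewrite integral_cst // EFinM -(lebesgue_itv st).
Qed.

Lemma log_concave_lower_density : lower_density nu.
Proof.
move=> L L0; exists (Num.min (phi L) (phi (- L))).
  by rewrite lt_min !phi_gt0.
move=> s t Ls st tL; apply: itv_integral_lower => //.
  by rewrite le_min !ltW.
(* Every point of [[-L, L]] is a convex combination of the endpoints; [L = 0] is set apart because
   the coefficient [r] divides by [2 * L]. *)
move=> u /andP[su ut]; have [L_eq0|Lneq0] := eqVneq L 0.
  by rewrite (_ : u = L) ?ge_min ?lexx //; lra.
have Lgt0 : 0 < L by rewrite lt_def Lneq0.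
pose r := (u + L) / (2 * L).
have rE : r * (2 * L) = u + L by rewrite /r divfK // mulf_neq0.
have -> : u = r * L + (1 - r) * - L by lra.
apply: log_concave_min; rewrite /r divr_ge0 ?mulr_ge0 //; last lra.
rewrite ler_pdivrMr ?mulr_gt0 // mul1r; lra.
Qed.

(** As [phi] is integrable, [phi x0 < phi 0] for some [x0 > 0]; by concavity [ln phi]
    then lies below the chord through [0] and [x0] beyond [x0]. *)
Lemma log_concave_tail : exists x0 beta, [/\ 0 < x0, 0 < beta &
  forall x, x0 <= x -> phi x <= phi 0 * expR (- beta * x)].
Proof.
have [[x0 x00 hx0]|H] := pselect (exists2 x0, 0 < x0 & phi x0 < phi 0); last first.
  (* Otherwise [phi] would be at least [phi 0] on the half-line, and [[0, N[] with [N > (phi 0)^-1]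
     would have mass above 1. *)
  exfalso; have h x : 0 <= x -> phi 0 <= phi x.
    rewrite le_eqVlt => /predU1P[<- //|x0]; rewrite leNgt; apply/negP => ?.
    by apply: H; exists x.
  pose N := (Num.truncn (phi 0)^-1).+1.
  have N0 : 0 <= N%:R :> R by [].
  have : ((phi 0 * (N%:R - 0))%:E <= 1)%E.
    apply: (@le_trans _ _ (nu `[0, N%:R[%classic)); last exact: probability_le1.
    by apply: itv_integral_lower => //; [exact: ltW|move=> u /andP[u0 _]; exact: h].
  rewrite subr0 lee_fin -ler_pdivlMl // mulr1 leNgt /N truncnS_gt //.
exists x0, ((ln (phi 0) - ln (phi x0)) / x0); split => //.
  by rewrite divr_gt0 // subr_gt0 ltr_ln ?posrE.
move=> x x0x; have x_gt0 : 0 < x by lra.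
have t01 : 0 <= x0 / x <= 1.
  apply/andP; split; first by rewrite divr_ge0 // ltW.
  by rewrite ler_pdivrMr // mul1r.
have := phi_lc x 0 t01; rewrite mulr0 addr0 divfK ?gt_eqF //.
rewrite -ler_ln ?posrE ?mulr_gt0 ?powR_gt0 // lnM ?posrE ?powR_gt0 // !ln_powR => h.
rewrite -[leLHS]lnK ?posrE // -[X in X * _]lnK ?posrE // -expRD ler_expR.
set A := ln (phi x) in h *; set B := ln (phi 0) in h *; set C := ln (phi x0) in h *.
have x0_neq0 : x0 != 0 by rewrite gt_eqF.
have x_neq0 : x != 0 by rewrite gt_eqF.
rewrite -subr_ge0 (_ : _ - A = (x / x0) * (C - (x0 / x * A + (1 - x0 / x) * B))).
  by rewrite mulr_ge0 ?divr_ge0 ?subr_ge0 // ltW.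
by field; rewrite x_neq0 x0_neq0.
Qed.

(** Since [delta > 0], only the right tail matters: on the [k]-th unit interval beyond [N] the
    integral is at most [C * r ^+ k], a geometric term because [delta < beta]. All small [delta] are
    covered because the initial law imposes its own upper limit. *)
Lemma exponential_moment : exists2 delta0, 0 < delta0 &
  forall delta, 0 < delta <= delta0 ->
  exists M : R, (\int[nu]_t (expR (delta * t))%:E <= M%:E)%E.
Proof.
have [x0 [beta [x00 beta0 tail]]] := log_concave_tail.
exists (beta / 2) => [|delta /andP[d0 dbeta]]; first by rewrite divr_gt0.
pose N := (Num.truncn x0).+1.
have x0N : x0 < N%:R by rewrite truncnS_gt.
pose I k : set R := `[(N + k)%:R, (N + k)%:R + 1[%classic.
have mI k : measurable (I k) by exact: measurable_itv.
pose h k (t : R) := ((expR (delta * ((N + k)%:R + 1)))%:E * (\1_(I k) t)%:E)%E.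
have h0 k t : (0 <= h k t)%E by rewrite mule_ge0 // lee_fin ?expR_ge0.
have mh k : measurable_fun setT (h k).
  by apply: measurable_funeM; exact/measurable_EFinP/measurable_indic.
pose C := phi 0 * expR (delta * (N%:R + 1)).
pose r := expR (- (beta - delta)).
have r01 : 0 < r < 1.
  by rewrite expR_gt0 /= -expR0 ltr_expR; lra.
have C0 : 0 <= C by rewrite mulr_ge0 ?expR_ge0 // ltW.
have hint k : (\int[nu]_t h k t <= (C * r ^+ k)%:E)%E.
  rewrite /h ge0_integralZl //; last by apply/measurable_EFinP; exact: measurable_indic.
  rewrite integral_indic // setIT.
  have up : (nu (I k) <=
      (phi 0 * expR (- beta * (N + k)%:R) * ((N + k)%:R + 1 - (N + k)%:R))%:E)%E.
    apply: itv_integral_upper; first by rewrite lerDl.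
      by rewrite mulr_ge0 ?expR_ge0 // ltW.
    move=> u /andP[Nu _]; have Nk : N%:R <= (N + k)%:R :> R by rewrite ler_nat leq_addr.
    apply: le_trans (tail _ _) _; first lra.
    by rewrite ler_pM2l // ler_expR !mulNr lerN2 ler_pM2l.
  apply: le_trans (lee_wpmul2l _ up) _; first by rewrite lee_fin expR_ge0.
  rewrite -EFinM lee_fin /C /r -expRM_natl.
  rewrite [leLHS](_ : _ =
    phi 0 * (expR (delta * ((N + k)%:R + 1)) * expR (- beta * (N + k)%:R))); last by ring.
  rewrite -[leRHS]mulrA -!expRD ler_pM2l // ler_expR natrD.
  have : 0 <= beta * N%:R by rewrite mulr_ge0 // ltW.
  lra.
have total : (\int[nu]_t (\sum_(0 <= k <oo) h k t) <= (C / (1 - r))%:E)%E.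
  rewrite integral_nneseries //.
  apply: (@le_trans _ _ (\sum_(0 <= k <oo) (C * r ^+ k)%:E)%E).
    apply: lee_nneseries => [k _ _|k _]; last exact: hint.
    by apply: integral_ge0 => t _; exact: h0.
  apply: lime_le.
    by apply: is_cvg_nneseries => k _ _; rewrite lee_fin mulr_ge0 //
      exprn_ge0 // ltW; case/andP: r01.
  apply: nearW => n; rewrite sumEFin lee_fin.
  case/andP: r01 => r0 r1.
  rewrite -[leLHS]/(series (geometric C r) n) geometric_seriesE ?lt_eqF //=.
  by rewrite ler_pM2r ?invr_gt0 ?subr_gt0 // ler_piMr // gerBl exprn_ge0 // ltW.
exists (expR (delta * N%:R) + C / (1 - r)).
rewrite EFinD.
apply: (@le_trans _ _ (\int[nu]_t ((expR (delta * N%:R))%:E + \sum_(0 <= k <oo) h k t))%E).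
  apply: ge0_le_integral => //.
  - by apply/measurable_EFinP; apply: measurableT_comp => //; exact: measurable_funM.
  - by apply: emeasurable_funD => //; exact: ge0_emeasurable_sum.
  move=> t _; have [tN|Nt] := leP t N%:R.
    apply: (@le_trans _ _ (expR (delta * N%:R))%:E).
      by rewrite lee_fin ler_expR ler_pM2l.
    by rewrite leeDl //; apply: nneseries_ge0.
  pose k := (Num.truncn t - N)%N.
  have t_ge0 : 0 <= t by apply: le_trans (ltW Nt).
  have Nk : (N + k = Num.truncn t)%N.
    by rewrite subnKC // -ltnS; rewrite -(ltr_nat R); apply: lt_trans Nt (truncnS_gt _).
  apply: (@le_trans _ _ (h k t)).
    rewrite /h indicE mem_set ?mule1; last first.
      rewrite /I /= in_itv /= Nk; apply/andP; split; first by rewrite truncn_le.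
      by rewrite natr1 truncnS_gt.
    by rewrite lee_fin ler_expR ler_pM2l // Nk natr1 ltW // truncnS_gt.
  apply: (@le_trans _ _ (\sum_(0 <= k <oo) h k t)%E); last first.
    by rewrite leeDr // lee_fin expR_ge0.
  apply: le_trans (nneseries_lim_ge k.+1 _) => //.
  by rewrite big_nat_recr //= leeDr // sume_ge0.
rewrite ge0_integralD //; last 2 first.
- by move=> t _; exact: nneseries_ge0.
- exact: ge0_emeasurable_sum.
rewrite leeD // integral_cst // -[leRHS]mule1 lee_wpmul2l ?lee_fin ?expR_ge0 //.
exact: probability_le1.
Qed.
End noise.

(** The joint law of [Y] and [X] agrees with the product measure on rectangles, hence everywhere;
    Tonelli's theorem then applies. *)
Lemma integral_independent (R : realType) d d' (T : measurableType d)
    (S : measurableType d') (P : probability T R) (Y : T -> S) (X : T -> R)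
    (nu : probability R R) (h : S * R -> \bar R) :
  measurable_fun setT Y -> measurable_fun setT X ->
  (forall A B, measurable A -> measurable B ->
    P (Y @^-1` A `&` X @^-1` B) = (P (Y @^-1` A) * nu B)%E) ->
  measurable_fun setT h -> (forall z, (0 <= h z)%E) ->
  (\int[P]_w h (Y w, X w) = \int[P]_w \int[nu]_t h (Y w, t))%E.
Proof.
move=> mY mX indep mh h0.
have mYX : measurable_fun setT (fun w => (Y w, X w)) by exact: measurable_fun_pair.
pose Y' : {mfun T >-> S} := mfun_Sub (mem_set mY).
pose YX' : {mfun T >-> (S * R)%type} := mfun_Sub (mem_set mYX).
have E : forall C, measurable C -> (distribution P Y' \x nu)%E C = distribution P YX' C.
  by move=> C mC; apply: product_measure_unique.
transitivity (\int[distribution P YX']_z h z)%E.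
  by rewrite ge0_integral_pushforward // preimage_setT.
transitivity (\int[distribution P Y' \x nu]_z h z)%E.
  by apply: eq_measure_integral => C mC _; exact/esym/E.
rewrite fubini_tonelli1 // ge0_integral_pushforward ?preimage_setT //.
  exact: measurable_fun_fubini_tonelli_F.
by move=> x _; apply: integral_ge0.
Qed.

(** * The Markov property of the autoregressive process *)

Section autoregression.
Context (R : realType) (p : nat) (phi : R -> R) (c : p.-tuple R)
  (d : measure_display) (T : measurableType d) (P : probability T R)
  (mu : probability (p.-tuple R) R) (Z xi : nat -> {RV P >-> R})
  (nu : probability R R).
Hypothesis hZ : ar_process mu phi c Z xi.
Hypothesis nuE : forall B : set R, measurable B ->
  nu B = (\int[lebesgue_measure]_(x in B) (phi x)%:E)%E.

Definition state n (w : T) : p.-tuple R := [tuple Z (n + j)%N w | j < p].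

(** The index counts the steps after the initial vector, so this is persistence up to time
    [p + n - 1]. *)
Definition alive n : set T := [set w | forall i, (i < p + n)%N -> 0 <= Z i w].

(** A pi-system generating the sigma-algebra of [Z_0, ..., Z_(p+n-1)]. *)
Definition history n : set (set T) :=
  [set E | exists (A : set (p.-tuple R)) (B : nat -> set R),
    [/\ measurable A, forall i, measurable (B i) &
        E = initial_vector p Z @^-1` A `&`
            \bigcap_(i in [set` iota p n]) (xi i @^-1` B i)]].

Let noise_law i B : (p <= i)%N -> measurable B -> P (xi i @^-1` B) = nu B.
Proof. by move=> pi mB; rewrite nuE //; case: hZ => _ [h _] _ _; exact: h. Qed.

Lemma measurable_initial_vector : measurable_fun setT (initial_vector p Z).
Proof.
apply/measurable_fun_tnthP => j.
rewrite (_ : _ \o _ = Z j) //.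
by apply/funext => w /=; rewrite tnth_mktuple.
Qed.

Lemma noise_block n (B : nat -> set R) : (forall i, measurable (B i)) ->
  sigma_noise p xi (\bigcap_(i in [set` iota p n]) (xi i @^-1` B i)).
Proof.
move=> mB; pose G := [set E | exists i (B : set R),
         [/\ (p <= i)%N, measurable B & E = xi i @^-1` B]].
have : measurable (\bigcap_(i in [set` iota p n]) (xi i @^-1` B i) :
    set (g_sigma_algebraType G)).
  apply: fin_bigcap_measurable; first exact: finite_seq.
  move=> i /=; rewrite mem_iota => /andP[pi _].
  by apply: sub_sigma_algebra; exists i, (B i).
by [].
Qed.

Lemma history_law n A (B : nat -> set R) :
  measurable A -> (forall i, measurable (B i)) ->
  P (initial_vector p Z @^-1` A `&` \bigcap_(i in [set` iota p n]) (xi i @^-1` B i))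
  = (P (initial_vector p Z @^-1` A) * \prod_(i <- iota p n) nu (B i))%E.
Proof.
move=> mA mB; case: hZ => _ [_ iid] indep _.
rewrite indep //; last exact: noise_block.
rewrite iid ?iota_uniq //; last by move=> i; rewrite mem_iota => /andP[].
congr (_ * _)%E; rewrite !big_seq; apply: eq_bigr => i.
by rewrite mem_iota => /andP[pi _]; exact: noise_law.
Qed.

Lemma history_setI_closed n : setI_closed (history n).
Proof.
move=> _ _ [A [B [mA mB ->]]] [A' [B' [mA' mB' ->]]].
exists (A `&` A'), (fun i => B i `&` B' i); split.
- exact: measurableI.
- by move=> i; exact: measurableI.
- rewrite setIACA -preimage_setI -bigcapI; congr (_ `&` _).
Qed.

Lemma history_measurable n : history n `<=` measurable.
Proof.
move=> _ [A [B [mA mB ->]]]; apply: measurableI.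
  by rewrite -[X in measurable X]setTI; exact: measurable_initial_vector.
apply: fin_bigcap_measurable; first exact: finite_seq.
by move=> i _; rewrite -[X in measurable X]setTI; exact: measurable_funP.
Qed.

Lemma setT_history n : history n setT.
Proof.
exists setT, (fun _ => setT); split => //.
by rewrite preimage_setT setTI; apply/seteqP; split.
Qed.

(** Both sides are finite measures in [E], so agreement on the pi-system [history n] suffices.
    There, intersecting with [F] merely lengthens the noise block by one factor. *)
Lemma history_indep n E (B : set R) : measurable B -> <<s history n >> E ->
  P (E `&` xi (p + n)%N @^-1` B) = (P E * nu B)%E.
Proof.
move=> mB hE; pose F := xi (p + n)%N @^-1` B.
have mF : measurable F by rewrite -[X in measurable X]setTI; exact: measurable_funP.
have nuB0 : 0 <= fine (nu B) by apply: fine_ge0.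
pose m1 := mrestr P mF; pose m2 := mscale (NngNum nuB0) P.
have nuBE : nu B = (fine (nu B))%:E by rewrite fineK // fin_num_measure.
have agree A : history n A -> m1 A = m2 A.
  move=> [A0 [B0 [mA0 mB0 ->]]]; rewrite /m1 /m2 /mrestr /mscale /= -nuBE.
  pose B1 i := if (i < p + n)%N then B0 i else B.
  have mB1 i : measurable (B1 i) by rewrite /B1; case: ifP.
  have B01 i : i \in iota p n -> B0 i = B1 i.
    by rewrite mem_iota => /andP[_ h]; rewrite /B1 h.
  have -> : initial_vector p Z @^-1` A0 `&` \bigcap_(i in [set` iota p n]) xi i @^-1` B0 i `&` F =
     initial_vector p Z @^-1` A0 `&` \bigcap_(i in [set` iota p n.+1]) xi i @^-1` B1 i.
    rewrite -setIA; congr (_ `&` _); rewrite -[n.+1]addn1 iotaD /=.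
    apply/seteqP; split => [w [h1 h2] i /=|w h].
      rewrite mem_cat => /orP[ii|]; first by rewrite -B01 //; exact: h1.
      by rewrite inE => /eqP ->; rewrite /B1 ltnn.
    split => [i /= ii|]; first by rewrite B01 //; apply: h; rewrite /= mem_cat ii.
    by have := h (p + n)%N; rewrite /= mem_cat inE eqxx orbT /B1 ltnn; apply.
  rewrite !history_law // -[n.+1]addn1 iotaD big_cat /= big_seq1 /B1 ltnn.
  rewrite muleA muleC; congr (_ * (_ * _))%E.
  by rewrite big_seq [RHS]big_seq; apply: eq_bigr => i hi; congr (nu _); exact/esym/B01.
have key : m1 E = m2 E.
  apply: (@g_sigma_algebra_measure_unique d R T (history n) (@history_measurable n)
    (fun _ => setT) (fun _ => setT_history n) _ m1 m2 (@history_setI_closed n)) hE => //.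
    by apply/seteqP; split => // w _; exists 0%N.
  move=> _; apply: (@le_lt_trans _ _ 1%E); last exact: ltry.
  exact: (probability_le1 P (measurableI _ _ measurableT mF)).
by move: key; rewrite /m1 /m2 /mrestr /mscale /= -nuBE muleC.
Qed.

Lemma measurable_history_Z n i : (i < p + n)%N ->
  measurable_fun setT (Z i : g_sigma_algebraType (history n) -> R).
Proof.
elim/ltn_ind: i => i IH ipn.
have [ip|pi] := ltnP i p.
  move=> _ B mB; rewrite setTI; apply: sub_sigma_algebra.
  exists ((fun x => tnth x (Ordinal ip)) @^-1` B), (fun _ => setT); split => //.
    by rewrite -[X in measurable X]setTI; apply: measurable_tnth.
  rewrite (_ : \bigcap_(_ in _) _ = setT) ?setIT; last by apply/seteqP; split.
  by apply/seteqP; split => w; rewrite /= tnth_mktuple.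
case: hZ => _ _ _ rec.
rewrite (_ : (Z i : _ -> R) =
    fun w => \sum_(j < p) tnth c j * Z (i - j.+1)%N w + xi i w); last first.
  by apply/funext => w; exact: rec.
apply: measurable_funD.
  apply: measurable_sum => j; apply: measurable_funM => //.
  have i0 : (0 < i)%N by apply: leq_trans pi; apply: leq_trans (ltn_ord j).
  apply: IH; first by rewrite ltn_subrL.
  by apply: leq_ltn_trans ipn; exact: leq_subr.
move=> _ B mB; rewrite setTI; apply: sub_sigma_algebra.
exists setT, (fun k => if k == i then B else setT); split => //.
  by move=> k; case: ifP.
rewrite preimage_setT setTI; apply/seteqP; split => w h.
  by move=> k /= _; case: eqP => // ->.
by have := h i; rewrite /= eqxx; apply; rewrite mem_iota pi.
Qed.

Lemma measurable_history_state n :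
  measurable_fun setT (state n : g_sigma_algebraType (history n) -> p.-tuple R).
Proof.
apply/measurable_fun_tnthP => j.
rewrite (_ : _ \o _ = (Z (n + j)%N : _ -> R)).
  by apply: measurable_history_Z; rewrite addnC ltn_add2r.
by apply/funext => w /=; rewrite tnth_mktuple.
Qed.

Lemma history_alive n : <<s history n >> (alive n).
Proof.
have : measurable (alive n : set (g_sigma_algebraType (history n))).
  have -> : alive n = \bigcap_(i in `I_(p + n)) ((Z i : _ -> R) @^-1` `[0, +oo[%classic).
    apply/seteqP; split => w h i /h; rewrite /= in_itv /= ?andbT //.
  apply: fin_bigcap_measurable => // i /= ipn.
  rewrite -[X in measurable X]setTI; apply: measurable_history_Z => //.
by [].
Qed.

Lemma lag_sum_state n w :
  lag_sum c (state n w) + xi (p + n)%N w = Z (p + n)%N w.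
Proof.
case: hZ => _ _ _ ->; last exact: leq_addr.
congr (_ + _); apply: eq_bigr => j _.
by rewrite tnth_mktuple /= addnBA // addnC.
Qed.

Lemma stateS n w :
  state n.+1 w = shift (state n w) (lag_sum c (state n w) + xi (p + n)%N w).
Proof.
apply: eq_from_tnth => j; rewrite lag_sum_state tnth_mktuple tnth_shift.
case: insubP => [k _ kE|]; first by rewrite tnth_mktuple kE addSnnS.
rewrite -leqNgt => pj; rewrite addSnnS addnC (_ : j.+1 = p) //.
by apply/eqP; rewrite eqn_leq ltn_ord.
Qed.

Lemma aliveS n w : alive n.+1 w <->
  alive n w /\ 0 <= lag_sum c (state n w) + xi (p + n)%N w.
Proof.
rewrite lag_sum_state /alive addnS; split => [h|[h1 h2] i].
  by split => [i ii|]; apply: h => //; apply: ltnW.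
by rewrite ltnS leq_eqVlt => /predU1P[->|/h1].
Qed.

(** The innovation [xi (p + n)] is integrated out, being independent of the past. [S] is [T] with
    the sigma-algebra of the past, so the identity map into [S] plays the part of the variable
    independent of the innovation. *)
Lemma alive_step n f : mnonneg f ->
  (\int[P]_w ((\1_(alive n.+1) w)%:E * f (state n.+1 w)) =
   \int[P]_w ((\1_(alive n) w)%:E * transition nu c f (state n w)))%E.
Proof.
move=> [mf f0]; pose S := g_sigma_algebraType (history n).
pose h (z : S * R) : \bar R :=
  ((\1_(alive n) z.1)%:E * surviving c f (state n z.1, z.2))%E.
have h0 z : (0 <= h z)%E by rewrite mule_ge0 ?surviving_ge0 // lee_fin.
have mh : measurable_fun setT h.
  apply: emeasurable_funM.
    apply/measurable_EFinP; apply: (@measurableT_comp _ _ _ _ _ _ (\1_(alive n) : S -> R)).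
      by apply: measurable_indic; exact: history_alive.
    exact: measurable_fst.
  apply: (measurableT_comp (measurable_surviving c mf)).
  apply: measurable_fun_pair; last exact: measurable_snd.
  exact: (measurableT_comp (@measurable_history_state n) measurable_fst).
have mid : measurable_fun setT (idfun : T -> S).
  move=> _ B mB; rewrite setTI.
  have := @smallest_sub _ _ _ _ (@sigma_algebra_measurable _ T) (@history_measurable n).
  exact.
have indep A B : measurable (A : set S) -> measurable B ->
    P ((idfun : T -> S) @^-1` A `&` xi (p + n)%N @^-1` B) =
    (P ((idfun : T -> S) @^-1` A) * nu B)%E.
  by move=> mA mB; exact: (@history_indep n).
have := @integral_independent R _ _ T S P idfun (xi (p + n)%N) nu h mid _ indep mh h0.
rewrite /h /= => E.
transitivity (\int[P]_w ((\1_(alive n) w)%:E * surviving c f (state n w, xi (p + n)%N w)))%E.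
  apply: eq_integral => w _; rewrite !indicE /surviving stateS /=.
  case: ifP => hs.
    congr ((_%:R)%:E * _)%E; congr nat_of_bool; apply/idP/idP; rewrite !inE.
      by move=> /aliveS[].
    by move=> ha; apply/aliveS.
  rewrite mule0 memNset ?mul0e // => /aliveS[_]; by rewrite hs.
rewrite E; last exact: measurable_funP.
apply: eq_integral => w _; rewrite /transition ge0_integralZl //.
  exact: measurable_surviving_pair.
by move=> t _; exact: surviving_ge0.
Qed.

Lemma alive_law n f : mnonneg f ->
  (\int[P]_w ((\1_(alive n) w)%:E * f (state n w)) =
   \int[P]_w ((\1_(alive 0) w)%:E * iter n (transition nu c) f (state 0 w)))%E.
Proof.
elim: n f => // n IH f gf.
rewrite (alive_step n gf) (IH _ (mnonneg_transition nu c gf)).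
by apply: eq_integral => w _; rewrite -iterSr.
Qed.

Lemma measurable_alive n : measurable (alive n).
Proof.
have := @smallest_sub _ _ _ _ (@sigma_algebra_measurable _ T) (@history_measurable n).
by apply; exact: history_alive.
Qed.

Lemma alive_probability n : P (alive n) =
  (\int[P]_w ((\1_(alive 0) w)%:E * survival nu c n (state 0 w)))%E.
Proof.
rewrite -alive_law; last exact: mnonneg_cst.
under eq_integral do rewrite mule1.
by rewrite integral_indic // ?setIT //; exact: measurable_alive.
Qed.

Definition nonneg_set : set (p.-tuple R) := [set x | nonneg x].

Lemma measurable_nonneg_set : measurable nonneg_set.
Proof.
have -> : nonneg_set = [set x | forall j, `[0, +oo[%classic (tnth x j)].
  by apply/seteqP; split => x /= h j; have := h j; rewrite /= in_itv /= andbT.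
by apply: measurable_rectangle; exact: measurable_itv.
Qed.

Lemma alive0E w : alive 0 w <-> nonneg (state 0 w).
Proof.
rewrite /alive addn0; split => [h j|h i ip]; last first.
  by have := h (Ordinal ip); rewrite tnth_mktuple.
by rewrite tnth_mktuple; exact: (h j (ltn_ord j)).
Qed.

Lemma initial_integral f : mnonneg f ->
  (\int[P]_w ((\1_(alive 0) w)%:E * f (state 0 w)) = \int[mu]_(x in nonneg_set) f x)%E.
Proof.
move=> [mf f0].
pose Y : {mfun T >-> p.-tuple R} := mfun_Sub (mem_set measurable_initial_vector).
transitivity (\int[distribution P Y]_(x in nonneg_set) f x)%E; last first.
  apply: eq_measure_integral => A mA _; case: hZ => h _ _ _; exact: h.
rewrite ge0_integral_pushforward //; last 2 first.
- exact: measurable_nonneg_set.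
- exact: measurable_funS mf.
rewrite [RHS]integral_mkcond; apply: eq_integral => w _.
rewrite patchE indicE; case: ifPn => [hw|hw].
  rewrite mem_set ?mul1e //; apply/alive0E.
  by move: hw; rewrite inE.
rewrite memNset ?mul0e // => /alive0E h.
by move: hw; rewrite notin_setE; apply.
Qed.

End autoregression.

(** * Identification of the persistence exponent for an admissible initial law *)

Section exponent.
Context (R : realType) (p : nat) (phi : R -> R) (c : p.-tuple R)
  (d : measure_display) (T : measurableType d) (P : probability T R)
  (mu : probability (p.-tuple R) R) (Z xi : nat -> {RV P >-> R})
  (nu : probability R R).
Hypothesis p_gt0 : (0 < p)%N.
Hypothesis sc : stable_coefficients c.
Hypothesis hmu : admissible_initial mu.
Hypothesis hZ : ar_process mu phi c Z xi.
Hypothesis nuE : forall B : set R, measurable B ->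
  nu B = (\int[lebesgue_measure]_(x in B) (phi x)%:E)%E.
Hypothesis dnu : lower_density nu.

(** The orthant is not open, so admissibility is applied to its interior. *)
Lemma nonneg_set_gt0 : (0 < mu (@nonneg_set R p))%E.
Proof.
pose U := [set x : 'rV[R]_p | forall j, 0 < x 0 j].
have oU : open U.
  rewrite openE => x xU.
  have near_pos (j : 'I_p) : \forall y \near x, 0 < (y : 'rV[R]_p) 0 j.
    have cont : (fun y : 'rV[R]_p => y 0 j) @ x --> x 0 j by exact: coord_continuous.
    exact: (cvgr_gt (x 0 j) cont 0 (xU j)).
  exact: filter_forall near_pos.
have U0 : U !=set0 by exists (const_mx 1) => j; rewrite mxE.
have mU : measurable [set z : p.-tuple R | U (\row_j tnth z j)].
  have -> : [set z : p.-tuple R | U (\row_j tnth z j)] =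
      [set z | forall j, `]0, +oo[%classic (tnth z j)].
    by apply/seteqP; split => z /= h j; have := h j; rewrite /= in_itv /= andbT mxE.
  by apply: measurable_rectangle; exact: measurable_itv.
case: hmu => h _; apply: lt_le_trans (h U oU U0 _) _; first by move=> x xU j; exact/ltW.
apply: le_measure; rewrite ?inE //; first exact: measurable_nonneg_set.
by move=> z zU j; have := zU j; rewrite mxE => /ltW.
Qed.

(** As the weights are at most 1, [weighted] is at most the sum of the entries, whose exponential
    moment is given; [delta'] must also respect the bound from the noise. *)
Lemma potential_integrable (delta : R) : 0 < delta ->
  exists2 delta', 0 < delta' <= delta &
    (\int[mu]_(x in @nonneg_set R p) potential c delta' x < +oo)%E.
Proof.
move=> d0; case: hmu => _ [delta1 d10 hfin].
exists (Num.min delta delta1); first by rewrite lt_min d0 d10 ge_min lexx.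
apply: le_lt_trans hfin.
have mS : measurable_fun setT (fun z : p.-tuple R => (expR (delta1 * \sum_(j < p) tnth z j))%:E).
  apply/measurable_EFinP; apply: measurableT_comp => //; apply: measurable_funM => //.
  by apply: measurable_sum => j; exact: measurable_tnth.
apply: ge0_le_integral.
- exact: measurable_nonneg_set.
- by move=> x _; rewrite lee_fin expR_ge0.
- by apply: measurable_funS (mnonneg_potential c _).1.
- exact: measurable_funS mS.
- move=> x x0; rewrite lee_fin ler_expR.
  apply: ler_pM; rewrite ?weighted_ge0 ?weighted_le //.
    by rewrite le_min !ltW.
  by rewrite ge_min lexx orbT.
Qed.

Lemma slope_cvg (s : nat -> R) (L E : R) (N : nat) :
  (forall n, (N <= n)%N -> n%:R * L - E <= s n <= n%:R * L + E) ->
  (n%:R^-1 * s n) @[n --> \oo] --> L.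
Proof.
move=> hs; apply/cvgrPdist_le => eps eps0.
pose M := (Num.truncn (E / eps)).+1; exists (N + M)%N => //= n NMn.
have Nn : (N <= n)%N := leq_trans (leq_addr M N) NMn.
have En : (M <= n)%N := leq_trans (leq_addl N M) NMn.
have n0 : 0 < n%:R :> R by rewrite ltr0n; apply: leq_trans En.
have Ene : E <= n%:R * eps.
  rewrite -ler_pdivrMr //; apply: ltW; apply: lt_le_trans (truncnS_gt _) _.
  by rewrite ler_nat.
have /andP[h1 h2] := hs n Nn.
rewrite -(ler_pM2l n0) -{1}(ger0_norm (ltW n0)) -normrM mulrBr mulrA divff ?gt_eqF // mul1r.
by rewrite ler_norml; apply/andP; split; lra.
Qed.

(** Up to constant factors the persistence probability is [survival0]: from below because every
    nonnegative initial state dominates the origin, from above by the integrated Harnack inequality.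
    The factors vanish in the limit. *)
Lemma persistence_exponentE (delta0 L D : R) : 0 < delta0 ->
  (forall delta, 0 < delta <= delta0 -> exists M : R,
     (\int[nu]_t (expR (delta * t))%:E <= M%:E)%E) ->
  (forall n, n%:R * L - D <= ln (survival0 nu c n) <= n%:R * L) ->
  persistence_exponent Z = expR L.
Proof.
move=> d00 moment hL.
have [delta dd hB] := potential_integrable d00.
have [M hM] := moment _ dd; have d0 : 0 < delta by case/andP: dd.
have [A A0 hA] := harnack p_gt0 sc dnu d0 hM.
have gV := mnonneg_potential c delta.
pose I := (\int[mu]_(x in @nonneg_set R p) potential c delta x)%E.
have I0 : (0 <= I)%E by apply: integral_ge0 => x _; case: gV.
pose B := fine I + 1.
have B0 : 0 < B by rewrite ltr_wpDl // fine_ge0.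
have IB : (I <= B%:E)%E.
  by rewrite -[I]fineK ?ge0_fin_numE // lee_fin lerDl.
pose alpha := fine (mu (@nonneg_set R p)).
have alphaE : mu (@nonneg_set R p) = alpha%:E.
  by rewrite fineK // fin_num_measure //; exact: measurable_nonneg_set.
have alpha0 : 0 < alpha by rewrite -lte_fin -alphaE nonneg_set_gt0.
have aliveE n : P (alive p Z n) = (\int[mu]_(x in @nonneg_set R p) survival nu c n x)%E.
  by rewrite (alive_probability hZ nuE) (initial_integral hZ) //; exact: mnonneg_surv.
have mO := @measurable_nonneg_set R p.
have U0 := survival0_gt0 sc dnu.
have lo n : ((alpha * survival0 nu c n)%:E <= P (alive p Z n))%E.
  rewrite aliveE mulrC EFinM -alphaE -integral_cst //.
  have [mu_ u0] := mnonneg_surv nu c n.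
  apply: ge0_le_integral => //.
  - by move=> x _; rewrite lee_fin ltW.
  - exact: measurable_funS mu_.
  - move=> x x0; rewrite /= -survival0E; apply: survival_incr => //.
    + exact: stable_nonneg.
    + exact: origin_nonneg.
    + by move=> j; rewrite tnth_mktuple; exact: x0.
have up n : (P (alive p Z n) <= (A * B * survival0 nu c n)%:E)%E.
  have [mu_ u0] := mnonneg_surv nu c n.
  have AU : 0 <= A * survival0 nu c n by rewrite mulr_ge0 ?ltW.
  rewrite aliveE.
  apply: (@le_trans _ _ (\int[mu]_(x in @nonneg_set R p)
      ((A * survival0 nu c n)%:E * potential c delta x))%E).
    apply: ge0_le_integral => //.
    - exact: measurable_funS mu_.
    - by apply: measurable_funS (mnonneg_scale AU gV).1.
    - by move=> x x0; exact: hA.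
  rewrite ge0_integralZl //; last 2 first.
  - by apply: measurable_funS gV.1.
  - by move=> x _; rewrite gV.2.
  by apply: le_trans (lee_wpmul2l _ IB) _; rewrite -?EFinM lee_fin // mulrAC.
pose s n := ln (persistence_probability Z n).
(* [persistence_probability Z n] involves [n + 1] values and [alive p Z m] involves [p + m], hence
   the predecessor. *)
have sE m : persistence_probability Z (p + m).-1 = fine (P (alive p Z m)).
  rewrite /persistence_probability /alive; congr (fine (P _)).
  have -> : (p + m = (p + m).-1.+1)%N by rewrite prednK // addn_gt0 p_gt0.
  by apply/seteqP; split.
have AB : 0 < A * B by rewrite mulr_gt0.
have fin m : P (alive p Z m) \is a fin_num.
  by rewrite fin_num_measure //; exact: (measurable_alive hZ).
have bounds m : ln alpha + (m%:R * L - D) <= s (p + m).-1 <= ln (A * B) + m%:R * L.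
  have := lo m; have := up m; rewrite -[P _]fineK // -sE !lee_fin => hu hl.
  have /andP[h1 h2] := hL m.
  have pp : 0 < persistence_probability Z (p + m).-1.
    by apply: lt_le_trans hl; rewrite mulr_gt0.
  rewrite /s; apply/andP; split.
    apply: (@le_trans _ _ (ln (alpha * survival0 nu c m))).
      by rewrite lnM ?posrE // lerD2l.
    by rewrite ler_ln ?posrE // mulr_gt0.
  apply: (@le_trans _ _ (ln (A * B * survival0 nu c m))).
    by rewrite ler_ln ?posrE // mulr_gt0.
  by rewrite lnM ?posrE // lerD2l.
rewrite /persistence_exponent; congr expR; apply: cvg_lim => //.
(* The last term pays for the shift by [p - 1] between time and number of steps. *)
pose E := `|ln alpha| + `|ln (A * B)| + `|D| + `|(p%:R - 1) * L|.
apply: (@slope_cvg s L E p) => n pn.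
have nE : (p + (n.+1 - p)).-1 = n by rewrite subnKC // ltnW.
have := bounds (n.+1 - p)%N; rewrite nE.
rewrite natrB; last exact: ltnW.
rewrite -natr1 /E.
set q := (p%:R - 1) * L; have -> : (n%:R + 1 - p%:R) * L = n%:R * L - q by rewrite /q; ring.
have := ler_norm (ln alpha); have := ler_norm (- ln alpha).
have := ler_norm (ln (A * B)); have := ler_norm (- ln (A * B)).
have := ler_norm D; have := ler_norm (- D); have := ler_norm q; have := ler_norm (- q).
rewrite !normrN => *; apply/andP; split; lra.
Qed.

End exponent.

Theorem theorem2p7 (R : realType) (p : nat) (phi : R -> R) (a b : p.-tuple R)
  (hp : (1 <= p)%N)
  (hphi : probability_density phi) (phi_gt0 : forall x, 0 < phi x)
  (phi_lc : log_concave phi)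
  (ha : stable_coefficients a) (hb : stable_coefficients b)
  (hab : forall j, tnth a j <= tnth b j) (hneq : b <> a)
  (da : measure_display) (Ta : measurableType da) (Pa : probability Ta R)
  (mua : probability (p.-tuple R) R) (Za xia : nat -> {RV Pa >-> R})
  (hmua : admissible_initial mua) (hZa : ar_process mua phi a Za xia)
  (db : measure_display) (Tb : measurableType db) (Pb : probability Tb R)
  (mub : probability (p.-tuple R) R) (Zb xib : nat -> {RV Pb >-> R})
  (hmub : admissible_initial mub) (hZb : ar_process mub phi b Zb xib) :
  persistence_exponent Zb > persistence_exponent Za.
Proof.
(* Both noises have density [phi], so the law of one innovation of the first process serves for
   both. *)
pose nu : probability R R := distribution Pa (xia p).
have nuE B : measurable B -> nu B = (\int[lebesgue_measure]_(x in B) (phi x)%:E)%E.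
  by move=> mB; case: hZa => _ [h _] _ _; exact: h.
have dnu : lower_density nu := log_concave_lower_density hphi phi_gt0 phi_lc nuE.
have [delta d0 moment] := exponential_moment hphi phi_gt0 phi_lc nuE.
have [M hM] : exists M : R, (\int[nu]_t (expR (delta * t))%:E <= M%:E)%E.
  by apply: moment; rewrite d0 lexx.
have [La [Da hLa]] := survival0_slope hp ha dnu d0 hM.
have [Lb [Db hLb]] := survival0_slope hp hb dnu d0 hM.
rewrite (persistence_exponentE hp ha hmua hZa nuE dnu d0 moment hLa).
rewrite (persistence_exponentE hp hb hmub hZb nuE dnu d0 moment hLb).
rewrite ltr_expR; apply: (slope_lt hp ha hb hab dnu d0 hM (D := Da)).
- by move=> ab; apply: hneq.
- by move=> n; case/andP: (hLa n).
- by move=> n; case/andP: (hLb n).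
Qed.
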